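(* Let $\alpha\in(0,1)$ and $r,q\in\mathbb{N}$ with $r\le q$. Then the (meromorphically continued) partial zeta function $\zeta(s;r,q)$ has the Taylor expansion $$\zeta(s;r,q)=\sum_{m=0}^{\infty}\frac{(-1)^m}{m!}\zeta_m(\alpha,r,q)(s-\alpha)^m,$$ valid for all $s\in D_\alpha:=\{s\in\mathbb{C}: |s-\alpha|<|\alpha-1|\}$.
   Context: $\zeta(s;r,q):=\sum_{n\ge1,\ n\equiv r \bmod q} n^{-s}$ for $\Re(s)>1$, continued meromorphically to $\mathbb{C}$ with only a simple pole at $s=1$ (via $\zeta(s;r,q)=q^{-s}\zeta(s,r/q)$, $\zeta(s,x)$ the Hurwitz zeta function). For $\alpha\in(0,1)$, $m\in\mathbb{N}_0$: $\zeta_m(\alpha,r,q):=\lim_{x\to\infty}\Big(\sum_{1\le n\le x,\ n\equiv r \bmod q}\frac{\log^m n}{n^{\alpha}}-\frac{I_m(x,\alpha)}{q}\Big)$ with $I_m(x,\alpha)=x^{1-\alpha}\sum_{i=0}^{m}(-1)^i\frac{m!}{(m-i)!}\frac{\log^{m-i}x}{(1-\alpha)^{i+1}}$. *)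

(* Defs.v *)
From Stdlib Require Import Reals Arith.
From Coquelicot Require Import Coquelicot.
Open Scope R_scope.

Definition Cexp (z : C) : C := (exp (Re z) * cos (Im z), exp (Re z) * sin (Im z)).

(* n^{-s} = exp (- s log n), used for n >= 1 only. *)
Definition nat_cpow_opp (n : nat) (s : C) : C :=
  Cexp (Copp (Cmult s (RtoC (ln (INR n))))).

Definition congr_mod (q n r : nat) : bool := Nat.eqb (n mod q) (r mod q).

Definition holomorphic_at (f : C -> C) (z : C) : Prop :=
  locally z (fun w : C => ex_derive (K := C_AbsRing) (V := C_NormedModule) f w).

Definition simple_pole (f : C -> C) (z : C) : Prop :=
  exists h : C -> C,
    holomorphic_at h z /\ h z <> RtoC 0 /\
    locally' z (fun w : C => f w = Cdiv (h w) (Cminus w z)).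

(* Z is the meromorphic continuation of the sum of n^{-s} over n >= 1 with
   n = r mod q.  It is unique away from s = 1; the value Z 1, at the pole, is
   unconstrained.  The series is indexed by k = n - 1. *)
Definition is_partial_zeta (r q : nat) (Z : C -> C) : Prop :=
  (forall s : C, 1 < Re s ->
     is_series (K := C_AbsRing) (V := C_NormedModule)
       (fun k : nat =>
          if congr_mod q (S k) r then nat_cpow_opp (S k) s else RtoC 0)
       (Z s)) /\
  (forall s : C, s <> RtoC 1 -> holomorphic_at Z s) /\
  simple_pole Z (RtoC 1).

Definition I_fun (m : nat) (x alpha : R) : R :=
  Rpower x (1 - alpha) *
  sum_n (fun i : nat =>
           (-1) ^ i * (INR (fact m) / INR (fact (m - i))) *
           ((ln x) ^ (m - i) / (1 - alpha) ^ (i + 1))) m.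

(* The term n = 1, m = 0 relies on pow 0 0 = 1. *)
Definition log_sum (m : nat) (alpha : R) (r q : nat) (x : R) : R :=
  sum_n_m (fun n : nat =>
             if congr_mod q n r
             then (ln (INR n)) ^ m / Rpower (INR n) alpha else 0)
          1 (Z.to_nat (Int_part x)).

(* Lim is total; this limit exists and is finite for 0 < alpha < 1 and q >= 1. *)
Definition zeta_coef (m : nat) (alpha : R) (r q : nat) : R :=
  real (Lim (fun x : R => log_sum m alpha r q x - I_fun m x alpha / INR q)
            p_infty).

(* Main.v *)
Require Import Defs.
From Stdlib Require Import Reals ZArith Arith Lra Lia Psatz ClassicalEpsilon.
From Coquelicot Require Import Coquelicot.
Open Scope R_scope.

(** Write [x_k = r + k q].  The entire functions
    [e_K(s) = (s-1) \sum_(k<K) x_k^(-s) + x_K^(1-s) / q] are uniformly Cauchy on bounded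
    parts of [Re s >= b > 0] and tend to [(s-1) Z(s)] for [Re s > 1]; since [(s-1) Z(s)] is
    entire, they tend to it for all [Re s > 0].  The [m]-th Taylor coefficient of
    [e_K(s) / (s-1)] at [alpha] is [(-1)^m / m!] times
    [\sum_(k<K) log^m x_k / x_k^alpha - I_m(x_K, alpha) / q], so these expressions converge
    to the corresponding multiple of the Taylor coefficient of [Z].  As [Z] is holomorphic
    off [1], its Taylor series at [alpha] represents it on the whole disc.

    Square contours suffice for the Taylor expansions: a square of half-side [rho] contains
    the disc of radius [rho], and if its centre is [alpha] and [rho < 1 - alpha] it still
    avoids the pole [1]. *)

(** * Complex differentiability *)

(** The obstacle is that [alpha < 1], while the series ties [Z] to the [e_K] only for [Re s > 1].
    The factor [s - 1] lets power series alone carry the convergence across the line [Re s = 1]: all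
    functions being entire, a disc about a large real point may contain 1 and still reach any given
    [s] with [Re s > 0], and convergence on it reduces to that of the coefficients at its centre.
    The Cauchy estimate telescopes: [e_(K+1) - e_K] is [(s-1)/q] times the error of the rectangle
    rule for the integral of [y^(-s)] over [[x_K, x_(K+1)]], of size [x_K^(-Re s - 1)], and this is
    dominated by a constant times [x_K^(-b) - x_(K+1)^(-b)]. The expressions [I_m] are, up to
    [(-1)^m / m!], the Taylor coefficients at [alpha] of [y^(1-s) / (1-s)]; it is enough to see this
    for real increments of [s], which already determine the coefficients. They are also
    antiderivatives of [log^m x / x^alpha], so for [alpha > 0] moving from a real [x] to the next
    [x_K] changes them by [o(1)]; this turns the limit along the progression into the limit over
    real [x]. *)

Definition Ccont (f : C -> C) (z : C) : Prop :=
  forall eps, 0 < eps -> exists d, 0 < d /\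
    forall w, Cmod (w - z) < d -> Cmod (f w - f z) < eps.

(** Differentiability at one point, with no continuity of the derivative; hence the vanishing of
    contour integrals needs Goursat's argument. The weak inequality admits [w = z]. *)
Definition Cdiff (f : C -> C) (z : C) : Prop :=
  exists l : C, forall eps, 0 < eps -> exists d, 0 < d /\
    forall w, Cmod (w - z) < d ->
      Cmod (f w - f z - l * (w - z)) <= eps * Cmod (w - z).

Lemma Cmod_pair_le (x y : R) : Cmod (x, y) <= Rabs x + Rabs y.
Proof.
  replace (x, y) with (RtoC x + Ci * RtoC y)%C
    by (unfold RtoC, Ci, Cplus, Cmult; simpl; f_equal; ring).
  eapply Rle_trans; [apply Cmod_triangle|].
  rewrite Cmod_mult, Cmod_Ci, !Cmod_R; lra.
Qed.

Lemma fst_le_Cmod (z : C) : Rabs (fst z) <= Cmod z.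
Proof. eapply Rle_trans; [apply Rmax_l|apply Rmax_Cmod]. Qed.

Lemma snd_le_Cmod (z : C) : Rabs (snd z) <= Cmod z.
Proof. eapply Rle_trans; [apply Rmax_r|apply Rmax_Cmod]. Qed.

Lemma Cmod_minus_sym (x y : C) : Cmod (x - y) = Cmod (y - x).
Proof. rewrite <- Cmod_opp; f_equal; ring. Qed.

Lemma Cmod_minus_triangle (x y z : C) : Cmod (x - z) <= Cmod (x - y) + Cmod (y - z).
Proof. replace (x - z)%C with ((x - y) + (y - z))%C by ring; apply Cmod_triangle. Qed.

Lemma Cmod_triangle_rev (x y : C) : Cmod x - Cmod y <= Cmod (x - y).
Proof.
  pose proof (Cmod_triangle (x - y) y).
  replace (x - y + y)%C with x in H by ring; lra.
Qed.

Lemma Cdiff_lipschitz (f : C -> C) (z : C) : Cdiff f z ->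
  exists K d, 0 < K /\ 0 < d /\
    forall w, Cmod (w - z) < d -> Cmod (f w - f z) <= K * Cmod (w - z).
Proof.
  intros [l H]; destruct (H 1 Rlt_0_1) as [d [Hd H']].
  exists (1 + Cmod l), d; pose proof (Cmod_ge_0 l).
  repeat split; [lra|lra|]; intros w Hw.
  replace (f w - f z)%C with ((f w - f z - l * (w - z)) + l * (w - z))%C by ring.
  eapply Rle_trans; [apply Cmod_triangle|].
  rewrite Cmod_mult; specialize (H' w Hw); lra.
Qed.

Lemma Cdiff_cont (f : C -> C) (z : C) : Cdiff f z -> Ccont f z.
Proof.
  intros H eps Heps; destruct (Cdiff_lipschitz f z H) as [K [d [HK [Hd H']]]].
  exists (Rmin d (eps / (2 * K))).
  assert (0 < eps / (2 * K)) by (apply Rdiv_lt_0_compat; lra).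
  split; [now apply Rmin_glb_lt|]; intros w Hw.
  eapply Rle_lt_trans;
    [apply H', (Rlt_le_trans _ _ _ Hw), Rmin_l|].
  pose proof (Rlt_le_trans _ _ _ Hw (Rmin_r _ _)).
  apply Rlt_trans with (K * (eps / (2 * K))).
  - now apply Rmult_lt_compat_l.
  - field_simplify; lra.
Qed.

Lemma Cdiff_const (c z : C) : Cdiff (fun _ => c) z.
Proof.
  exists (RtoC 0); intros eps Heps; exists 1; split; [lra|]; intros w _.
  replace (c - c - 0 * (w - z))%C with (RtoC 0) by ring.
  rewrite Cmod_0; pose proof (Cmod_ge_0 (w - z)); nra.
Qed.

Lemma Cdiff_id (z : C) : Cdiff (fun w => w) z.
Proof.
  exists (RtoC 1); intros eps Heps; exists 1; split; [lra|]; intros w _.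
  replace (w - z - 1 * (w - z))%C with (RtoC 0) by ring.
  rewrite Cmod_0; pose proof (Cmod_ge_0 (w - z)); nra.
Qed.

Lemma Cdiff_plus (f g : C -> C) (z : C) :
  Cdiff f z -> Cdiff g z -> Cdiff (fun w => f w + g w)%C z.
Proof.
  intros [l H] [m H']; exists (l + m)%C; intros eps Heps.
  destruct (H (eps / 2)) as [d [Hd H1]]; [lra|].
  destruct (H' (eps / 2)) as [d' [Hd' H1']]; [lra|].
  exists (Rmin d d'); split; [now apply Rmin_glb_lt|]; intros w Hw.
  specialize (H1 w (Rlt_le_trans _ _ _ Hw (Rmin_l _ _))).
  specialize (H1' w (Rlt_le_trans _ _ _ Hw (Rmin_r _ _))).
  replace (f w + g w - (f z + g z) - (l + m) * (w - z))%C with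
    ((f w - f z - l * (w - z)) + (g w - g z - m * (w - z)))%C by ring.
  eapply Rle_trans; [apply Cmod_triangle|]; lra.
Qed.

Lemma Cdiff_comp (f g : C -> C) (z : C) :
  Cdiff g z -> Cdiff f (g z) -> Cdiff (fun w => f (g w)) z.
Proof.
  intros Hg [l Hf]; destruct (Cdiff_lipschitz g z Hg) as [K [d0 [HK [Hd0 HL]]]].
  destruct Hg as [m Hg]; exists (l * m)%C; intros eps Heps.
  pose proof (Cmod_ge_0 l).
  destruct (Hf (eps / (2 * K))) as [d1 [Hd1 H1]];
    [apply Rdiv_lt_0_compat; lra|].
  destruct (Hg (eps / (2 * (1 + Cmod l)))) as [d2 [Hd2 H2]];
    [apply Rdiv_lt_0_compat; lra|].
  assert (Hq : 0 < d1 / K) by now apply Rdiv_lt_0_compat.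
  exists (Rmin d0 (Rmin d2 (d1 / K))); split; [repeat apply Rmin_glb_lt; lra|].
  intros w Hw.
  pose proof (Rlt_le_trans _ _ _ Hw (Rmin_l _ _)) as Hw0.
  pose proof (Rlt_le_trans _ _ _ Hw (Rmin_r _ _)) as Hw'.
  pose proof (Rlt_le_trans _ _ _ Hw' (Rmin_l _ _)) as Hw2.
  pose proof (Rlt_le_trans _ _ _ Hw' (Rmin_r _ _)) as Hw3.
  specialize (HL w Hw0); specialize (H2 w Hw2).
  assert (Hgw : Cmod (g w - g z) < d1).
  { eapply Rle_lt_trans; [exact HL|].
    apply Rlt_le_trans with (K * (d1 / K)); [now apply Rmult_lt_compat_l|].
    right; field; lra. }
  specialize (H1 _ Hgw).
  replace (f (g w) - f (g z) - l * m * (w - z))%C with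
    ((f (g w) - f (g z) - l * (g w - g z)) + l * (g w - g z - m * (w - z)))%C by ring.
  eapply Rle_trans; [apply Cmod_triangle|]; rewrite Cmod_mult.
  pose proof (Cmod_ge_0 (w - z)).
  apply Rle_trans with (eps / 2 * Cmod (w - z) + eps / 2 * Cmod (w - z)); [|lra].
  apply Rplus_le_compat.
  - eapply Rle_trans; [exact H1|].
    apply Rle_trans with (eps / (2 * K) * (K * Cmod (w - z))).
    + apply Rmult_le_compat_l; [|exact HL].
      apply Rlt_le, Rdiv_lt_0_compat; lra.
    + right; field; lra.
  - apply Rle_trans with
      ((1 + Cmod l) * (eps / (2 * (1 + Cmod l)) * Cmod (w - z))).
    + apply Rmult_le_compat; try apply Cmod_ge_0; lra.
    + right; field; lra.
Qed.

Lemma Cdiff_sqr (z : C) : Cdiff (fun w => w * w)%C z.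
Proof.
  exists (z + z)%C; intros eps Heps; exists eps; split; [lra|]; intros w Hw.
  replace (w * w - z * z - (z + z) * (w - z))%C with ((w - z) * (w - z))%C by ring.
  rewrite Cmod_mult; pose proof (Cmod_ge_0 (w - z)); nra.
Qed.

Lemma Cdiff_scal (c : C) (f : C -> C) (z : C) :
  Cdiff f z -> Cdiff (fun w => c * f w)%C z.
Proof.
  intros [l H]; exists (c * l)%C; intros eps Heps; pose proof (Cmod_ge_0 c).
  destruct (H (eps / (1 + Cmod c))) as [d [Hd H1]]; [apply Rdiv_lt_0_compat; lra|].
  exists d; split; [lra|]; intros w Hw; specialize (H1 w Hw).
  replace (c * f w - c * f z - c * l * (w - z))%C with
    (c * (f w - f z - l * (w - z)))%C by ring.
  rewrite Cmod_mult.
  apply Rle_trans with ((1 + Cmod c) * (eps / (1 + Cmod c) * Cmod (w - z))).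
  - apply Rmult_le_compat; try apply Cmod_ge_0; lra.
  - right; field; lra.
Qed.

Lemma Cdiff_ext (f g : C -> C) (z : C) :
  (forall w, f w = g w) -> Cdiff f z -> Cdiff g z.
Proof.
  intros E [l H]; exists l; intros eps Heps; destruct (H eps Heps) as [d [Hd H1]].
  exists d; split; [lra|]; intros w Hw; rewrite <- !E; now apply H1.
Qed.

Lemma Cdiff_ext_loc (f g : C -> C) (z : C) (r : R) : 0 < r ->
  (forall w, Cmod (w - z) < r -> f w = g w) -> Cdiff f z -> Cdiff g z.
Proof.
  intros Hr E [l H]; exists l; intros eps Heps; destruct (H eps Heps) as [d [Hd H1]].
  exists (Rmin d r); split; [now apply Rmin_glb_lt|]; intros w Hw.
  rewrite <- !E.
  - apply H1, (Rlt_le_trans _ _ _ Hw), Rmin_l.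
  - replace (z - z)%C with (RtoC 0) by ring; now rewrite Cmod_0.
  - apply (Rlt_le_trans _ _ _ Hw), Rmin_r.
Qed.

Lemma Cdiff_minus (f g : C -> C) (z : C) :
  Cdiff f z -> Cdiff g z -> Cdiff (fun w => f w - g w)%C z.
Proof.
  intros Hf Hg; apply Cdiff_ext with (fun w => f w + (- RtoC 1) * g w)%C.
  - intros w; ring.
  - apply Cdiff_plus; [exact Hf|now apply Cdiff_scal].
Qed.

(* Polarization: 4 f g = (f + g)^2 - (f - g)^2. *)
Lemma Cdiff_mult (f g : C -> C) (z : C) :
  Cdiff f z -> Cdiff g z -> Cdiff (fun w => f w * g w)%C z.
Proof.
  intros Hf Hg.
  apply Cdiff_ext with (fun w => / RtoC 4 *
     ((f w + g w) * (f w + g w) - (f w - g w) * (f w - g w)))%C.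
  - intros w; field; intros E; apply RtoC_inj in E; lra.
  - apply Cdiff_scal, Cdiff_minus.
    + apply (Cdiff_comp (fun w => w * w)%C (fun w => f w + g w)%C);
        [now apply Cdiff_plus|apply Cdiff_sqr].
    + apply (Cdiff_comp (fun w => w * w)%C (fun w => f w - g w)%C);
        [now apply Cdiff_minus|apply Cdiff_sqr].
Qed.

Lemma Cdiff_inv (z : C) : z <> RtoC 0 -> Cdiff Cinv z.
Proof.
  intros Hz; pose proof (proj1 (Cmod_gt_0 z) Hz) as Hm.
  exists (- / (z * z))%C; intros eps Heps.
  set (m := Cmod z) in *.
  assert (Hq : 0 < eps * m ^ 3 / 2)
    by (apply Rdiv_lt_0_compat; [apply Rmult_lt_0_compat; [|apply pow_lt]|]; lra).
  (* The remainder is exactly [(w - z)^2 / (w z^2)]. The first radius gives [|w| > m / 2], and then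
     the second gives [|w - z| <= eps |w| m^2]. *)
  exists (Rmin (m / 2) (eps * m ^ 3 / 2)); split; [apply Rmin_glb_lt; lra|].
  intros w Hw.
  pose proof (Rlt_le_trans _ _ _ Hw (Rmin_l _ _)) as H1.
  pose proof (Rlt_le_trans _ _ _ Hw (Rmin_r _ _)) as H2.
  assert (Hwm : m / 2 < Cmod w).
  { pose proof (Cmod_triangle_rev z w); rewrite Cmod_minus_sym in H; fold m in H; lra. }
  assert (Hw0 : w <> RtoC 0) by (apply Cmod_gt_0; lra).
  replace (/ w - / z - - / (z * z) * (w - z))%C with
    ((w - z) * (w - z) / (w * (z * z)))%C by (field; tauto).
  rewrite Cmod_div by (repeat apply Cmult_neq_0; assumption).
  rewrite !Cmod_mult; fold m.
  pose proof (Cmod_ge_0 (w - z)).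
  unfold Rdiv; rewrite Rmult_assoc, Rmult_comm.
  apply Rmult_le_compat_r; [lra|].
  assert (0 < m * m) by (apply Rmult_lt_0_compat; lra).
  assert (m / 2 * (m * m) <= Cmod w * (m * m)) by (apply Rmult_le_compat_r; lra).
  replace (eps * m ^ 3 / 2) with (eps * (m / 2 * (m * m))) in H2 by field.
  assert (0 < Cmod w * (m * m)) by (apply Rmult_lt_0_compat; lra).
  apply Rmult_le_reg_r with (Cmod w * (m * m)); [lra|].
  rewrite Rmult_assoc, Rinv_l by lra.
  apply Rmult_le_compat_l with (r := eps) in H3; lra.
Qed.

Lemma Cdiff_div (f g : C -> C) (z : C) :
  Cdiff f z -> Cdiff g z -> g z <> RtoC 0 -> Cdiff (fun w => f w / g w)%C z.
Proof.
  intros Hf Hg Hz; unfold Cdiv; apply Cdiff_mult; [exact Hf|].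
  now apply (Cdiff_comp Cinv g); [|apply Cdiff_inv].
Qed.

Lemma Cdiff_pow (f : C -> C) (n : nat) (z : C) :
  Cdiff f z -> Cdiff (fun w => Cpow (f w) n) z.
Proof.
  intros H; induction n as [|n IH]; simpl.
  - apply Cdiff_const.
  - now apply Cdiff_mult.
Qed.

Lemma locally_C_ball (z : C) (P : C -> Prop) :
  @locally (AbsRing_UniformSpace C_AbsRing) z P ->
  exists d, 0 < d /\ forall w, Cmod (w - z) < d -> P w.
Proof. intros [d H]; exists d; split; [apply d|]; intros w Hw; apply H, Hw. Qed.

Lemma ex_derive_Cdiff (f : C -> C) (z : C) :
  ex_derive (K := C_AbsRing) (V := C_NormedModule) f z -> Cdiff f z.
Proof.
  intros [l [_ H]]; exists l; intros eps Heps.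
  specialize (H z (fun P H => H) (mkposreal eps Heps)).
  destruct (locally_C_ball _ _ H) as [d [Hd H']].
  exists d; split; [exact Hd|]; intros w Hw; specialize (H' w Hw); simpl in H'.
  change (Cmod (f w - f z - (w - z) * l) <= eps * Cmod (w - z)) in H'.
  now rewrite (Cmult_comm l).
Qed.

Lemma holomorphic_at_Cdiff (f : C -> C) (z : C) : holomorphic_at f z -> Cdiff f z.
Proof.
  intros H; apply ex_derive_Cdiff.
  exact (locally_singleton _ _ H).
Qed.

(** * Contour integrals and Goursat's theorem *)

(** The parameter is real, so C enters as a real normed space. Its balls are products of intervals,
    which is why estimates pass through the two coordinates. *)
Definition Cint (f : R -> C) (a b : R) : C :=
  RInt (V := C_R_CompleteNormedModule) f a b.

Definition pathcont (f : R -> C) (t : R) : Prop :=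
  continuous (U := C_R_NormedModule) f t.

Lemma pathcont_eps (f : R -> C) (t : R) :
  (forall eps, 0 < eps -> exists d, 0 < d /\
     forall u, Rabs (u - t) < d -> Cmod (f u - f t) < eps) -> pathcont f t.
Proof.
  intros H; apply filterlim_locally; intros eps.
  destruct (H eps (cond_pos eps)) as [d [Hd H']].
  exists (mkposreal d Hd); intros u Hu; specialize (H' u Hu).
  split.
  - eapply Rle_lt_trans; [|exact H']; apply (fst_le_Cmod (f u - f t)).
  - eapply Rle_lt_trans; [|exact H']; apply (snd_le_Cmod (f u - f t)).
Qed.

Lemma pathcont_h (f : C -> C) (x y : R) :
  Ccont f (x, y) -> pathcont (fun t => f (t, y)) x.
Proof.
  intros H; apply pathcont_eps; intros eps Heps.
  destruct (H eps Heps) as [d [Hd H']]; exists d; split; [exact Hd|].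
  intros u Hu; apply H'.
  replace ((u, y) - (x, y))%C with (RtoC (u - x))
    by (unfold RtoC, Cminus, Cplus, Copp; simpl; f_equal; ring).
  now rewrite Cmod_R.
Qed.

Lemma pathcont_v (f : C -> C) (x y : R) :
  Ccont f (x, y) -> pathcont (fun t => f (x, t)) y.
Proof.
  intros H; apply pathcont_eps; intros eps Heps.
  destruct (H eps Heps) as [d [Hd H']]; exists d; split; [exact Hd|].
  intros u Hu; apply H'.
  replace ((x, u) - (x, y))%C with (Ci * RtoC (u - y))%C
    by (unfold RtoC, Ci, Cminus, Cplus, Copp, Cmult; simpl; f_equal; ring).
  now rewrite Cmod_mult, Cmod_Ci, Cmod_R, Rmult_1_l.
Qed.

Definition segcont (f : R -> C) (a b : R) : Prop :=
  forall t, a <= t <= b -> pathcont f t.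

Lemma Cint_ex (f : R -> C) (a b : R) : a <= b -> segcont f a b ->
  ex_RInt (V := C_R_CompleteNormedModule) f a b.
Proof.
  intros Hab H; apply (ex_RInt_continuous (V := C_R_CompleteNormedModule)).
  rewrite Rmin_left, Rmax_right by lra; exact H.
Qed.

Lemma Cint_correct (f : R -> C) (a b : R) : a <= b -> segcont f a b ->
  is_RInt (V := C_R_NormedModule) f a b (Cint f a b).
Proof.
  intros Hab H.
  apply (RInt_correct (V := C_R_CompleteNormedModule)); now apply Cint_ex.
Qed.

Lemma Cint_unique (f : R -> C) (a b : R) (l : C) :
  is_RInt (V := C_R_NormedModule) f a b l -> Cint f a b = l.
Proof. apply (is_RInt_unique (V := C_R_CompleteNormedModule)). Qed.

Lemma Cint_Chasles (f : R -> C) (a b c : R) : a <= b -> b <= c -> segcont f a c ->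
  Cint f a c = (Cint f a b + Cint f b c)%C.
Proof.
  intros Hab Hbc H; symmetry.
  apply (RInt_Chasles (V := C_R_CompleteNormedModule)); apply Cint_ex; try assumption;
    intros t Ht; apply H; lra.
Qed.

Lemma Cint_plus (f g : R -> C) (a b : R) : a <= b -> segcont f a b -> segcont g a b ->
  Cint (fun t => f t + g t)%C a b = (Cint f a b + Cint g a b)%C.
Proof.
  intros Hab Hf Hg; apply Cint_unique.
  apply (is_RInt_plus (V := C_R_NormedModule)); now apply Cint_correct.
Qed.

(** The integral is only real-linear by construction; complex linearity is checked on
    coordinates. *)
Lemma is_RInt_Cmult (c : C) (f : R -> C) (a b : R) (l : C) :
  is_RInt (V := C_R_NormedModule) f a b l ->
  is_RInt (V := C_R_NormedModule) (fun t => c * f t)%C a b (c * l)%C.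
Proof.
  intros H.
  pose proof (is_RInt_fct_extend_fst (U := R_NormedModule) (V := R_NormedModule) f a b l H) as H1.
  pose proof (is_RInt_fct_extend_snd (U := R_NormedModule) (V := R_NormedModule) f a b l H) as H2.
  apply (is_RInt_fct_extend_pair (U := R_NormedModule) (V := R_NormedModule)); simpl.
  - apply (is_RInt_minus (V := R_NormedModule) (fun t => fst c * fst (f t)) (fun t => snd c * snd (f t)));
      now apply (is_RInt_scal (V := R_NormedModule)).
  - apply (is_RInt_plus (V := R_NormedModule) (fun t => fst c * snd (f t)) (fun t => snd c * fst (f t)));
      now apply (is_RInt_scal (V := R_NormedModule)).
Qed.

Lemma Cint_scal (c : C) (f : R -> C) (a b : R) : a <= b -> segcont f a b ->
  Cint (fun t => c * f t)%C a b = (c * Cint f a b)%C.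
Proof.
  intros Hab Hf; apply Cint_unique, is_RInt_Cmult; now apply Cint_correct.
Qed.

Lemma norm_C_R (z : C) : norm (V := C_R_NormedModule) z = Cmod z.
Proof.
  unfold Cmod; rewrite <- (pow2_abs (fst z)), <- (pow2_abs (snd z)); reflexivity.
Qed.

Lemma Cint_bound (f : R -> C) (a b M : R) : a <= b -> segcont f a b ->
  (forall t, a <= t <= b -> Cmod (f t) <= M) -> Cmod (Cint f a b) <= (b - a) * M.
Proof.
  intros Hab Hf HM.
  rewrite <- norm_C_R.
  apply (norm_RInt_le_const (V := C_R_NormedModule) f a b); [exact Hab| |].
  { intros t Ht; rewrite norm_C_R; now apply HM. }
  now apply Cint_correct.
Qed.

Lemma Cint_ext (f g : R -> C) (a b : R) : a <= b ->
  (forall t, a <= t <= b -> f t = g t) -> Cint f a b = Cint g a b.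
Proof.
  intros Hab H; apply (RInt_ext (V := C_R_CompleteNormedModule)).
  rewrite Rmin_left, Rmax_right by lra; intros t Ht; apply H; lra.
Qed.

(** * Rectangles and integrals along their boundaries *)

Definition on_rect (P : C -> Prop) (a b c d : R) : Prop :=
  forall x y, a <= x <= b -> c <= y <= d -> P (x, y).

(** Counterclockwise, with [dz = dx] on the horizontal sides and [dz = i dy] on the vertical
    ones. *)
Definition rect_contour (f : C -> C) (a b c d : R) : C :=
  (Cint (fun x => f (x, c)) a b - Cint (fun x => f (x, d)) a b
   + Ci * (Cint (fun y => f (b, y)) c d - Cint (fun y => f (a, y)) c d))%C.

Lemma on_rect_sub (P : C -> Prop) (a b c d a' b' c' d' : R) :
  on_rect P a b c d -> a <= a' -> b' <= b -> c <= c' -> d' <= d ->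
  on_rect P a' b' c' d'.
Proof. intros H **; intros x y Hx Hy; apply H; lra. Qed.

Lemma on_rect_impl (P Q : C -> Prop) (a b c d : R) :
  (forall z, P z -> Q z) -> on_rect P a b c d -> on_rect Q a b c d.
Proof. intros PQ H x y Hx Hy; auto. Qed.

Lemma segcont_h (f : C -> C) (a b c d y : R) :
  on_rect (Ccont f) a b c d -> c <= y <= d -> segcont (fun x => f (x, y)) a b.
Proof. intros H Hy t Ht; apply pathcont_h, H; lra. Qed.

Lemma segcont_v (f : C -> C) (a b c d x : R) :
  on_rect (Ccont f) a b c d -> a <= x <= b -> segcont (fun y => f (x, y)) c d.
Proof. intros H Hy t Ht; apply pathcont_v, H; lra. Qed.

Lemma rect_contour_split_v (f : C -> C) (a m b c d : R) :
  a <= m <= b -> c <= d -> on_rect (Ccont f) a b c d ->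
  rect_contour f a b c d = (rect_contour f a m c d + rect_contour f m b c d)%C.
Proof.
  intros Hm Hcd H; unfold rect_contour.
  rewrite (Cint_Chasles (fun x => f (x, c)) a m b), (Cint_Chasles (fun x => f (x, d)) a m b);
    try lra; try (apply (segcont_h f a b c d); [exact H|lra]).
  ring.
Qed.

Lemma rect_contour_split_h (f : C -> C) (a b c m d : R) :
  a <= b -> c <= m <= d -> on_rect (Ccont f) a b c d ->
  rect_contour f a b c d = (rect_contour f a b c m + rect_contour f a b m d)%C.
Proof.
  intros Hab Hm H; unfold rect_contour.
  rewrite (Cint_Chasles (fun x => f (b, x)) c m d), (Cint_Chasles (fun x => f (a, x)) c m d);
    try lra; try (apply (segcont_v f a b c d); [exact H|lra]).
  ring.
Qed.

(** Conditions on the edges alone admit integrands with a singularity inside, such as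
    [f w / (w - s)]. *)
Definition on_boundary (P : C -> Prop) (a b c d : R) : Prop :=
  (forall x, a <= x <= b -> P (x, c) /\ P (x, d)) /\
  (forall y, c <= y <= d -> P (a, y) /\ P (b, y)).

Lemma on_rect_boundary (P : C -> Prop) (a b c d : R) : a <= b -> c <= d ->
  on_rect P a b c d -> on_boundary P a b c d.
Proof. intros Hab Hcd H; split; intros t Ht; split; apply H; lra. Qed.

Lemma segcont_boundary (f : C -> C) (a b c d : R) : on_boundary (Ccont f) a b c d ->
  segcont (fun x => f (x, c)) a b /\ segcont (fun x => f (x, d)) a b /\
  segcont (fun y => f (a, y)) c d /\ segcont (fun y => f (b, y)) c d.
Proof.
  intros [H1 H2]; repeat split; intros t Ht;
    (apply pathcont_h, H1 || apply pathcont_v, H2); exact Ht.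
Qed.

Ltac boundary_segcont := repeat match goal with
  H : on_boundary (Ccont _) _ _ _ _ |- _ => destruct (segcont_boundary _ _ _ _ _ H) as (? & ? & ? & ?); clear H end.

Lemma rect_contour_plus (f g : C -> C) (a b c d : R) :
  a <= b -> c <= d -> on_boundary (Ccont f) a b c d -> on_boundary (Ccont g) a b c d ->
  rect_contour (fun w => f w + g w)%C a b c d = (rect_contour f a b c d + rect_contour g a b c d)%C.
Proof.
  intros Hab Hcd Hf Hg; boundary_segcont; unfold rect_contour.
  rewrite !Cint_plus by assumption; ring.
Qed.

Lemma rect_contour_scal (k : C) (f : C -> C) (a b c d : R) :
  a <= b -> c <= d -> on_boundary (Ccont f) a b c d ->
  rect_contour (fun w => k * f w)%C a b c d = (k * rect_contour f a b c d)%C.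
Proof.
  intros Hab Hcd Hf; boundary_segcont; unfold rect_contour.
  rewrite !Cint_scal by assumption; ring.
Qed.

Lemma rect_contour_ext (f g : C -> C) (a b c d : R) : a <= b -> c <= d ->
  on_boundary (fun z => f z = g z) a b c d -> rect_contour f a b c d = rect_contour g a b c d.
Proof.
  intros Hab Hcd [H1 H2]; unfold rect_contour.
  rewrite (Cint_ext (fun x => f (x, c)) (fun x => g (x, c))),
    (Cint_ext (fun x => f (x, d)) (fun x => g (x, d))),
    (Cint_ext (fun y => f (a, y)) (fun y => g (a, y))),
    (Cint_ext (fun y => f (b, y)) (fun y => g (b, y))); try lra; try reflexivity;
    intros; (apply H1 || apply H2); lra.
Qed.

Lemma rect_contour_bound (f : C -> C) (a b c d M : R) :
  a <= b -> c <= d -> on_boundary (Ccont f) a b c d ->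
  on_boundary (fun z => Cmod (f z) <= M) a b c d ->
  Cmod (rect_contour f a b c d) <= 2 * ((b - a) + (d - c)) * M.
Proof.
  intros Hab Hcd Hf [H1 H2]; boundary_segcont; unfold rect_contour.
  eapply Rle_trans; [apply Cmod_triangle|].
  rewrite Cmod_mult, Cmod_Ci, Rmult_1_l.
  unfold Cminus.
  pose proof (Cmod_triangle (Cint (fun x => f (x, c)) a b) (- Cint (fun x => f (x, d)) a b)).
  pose proof (Cmod_triangle (Cint (fun y => f (b, y)) c d) (- Cint (fun y => f (a, y)) c d)).
  rewrite !Cmod_opp in *.
  assert (Cmod (Cint (fun x => f (x, c)) a b) <= (b - a) * M)
    by (apply Cint_bound; [lra|assumption|apply H1]).
  assert (Cmod (Cint (fun x => f (x, d)) a b) <= (b - a) * M)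
    by (apply Cint_bound; [lra|assumption|apply H1]).
  assert (Cmod (Cint (fun y => f (a, y)) c d) <= (d - c) * M)
    by (apply Cint_bound; [lra|assumption|apply H2]).
  assert (Cmod (Cint (fun y => f (b, y)) c d) <= (d - c) * M)
    by (apply Cint_bound; [lra|assumption|apply H2]).
  lra.
Qed.

Lemma rect_contour_const (k : C) (a b c d : R) : rect_contour (fun _ => k) a b c d = RtoC 0.
Proof. unfold rect_contour; ring. Qed.

Lemma is_RInt_idR (a b : R) :
  is_RInt (V := R_NormedModule) (fun t => t) a b ((b * b - a * a) / 2).
Proof.
  replace ((b * b - a * a) / 2) with (minus (b * b / 2) (a * a / 2))
    by (unfold minus, plus, opp; simpl; field).
  apply (is_RInt_derive (V := R_CompleteNormedModule) (fun t => t * t / 2)).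
  - intros x _; auto_derive; [trivial|]; field.
  - intros x _; apply continuous_id.
Qed.

Lemma rect_contour_id (a b c d : R) : rect_contour (fun w => w) a b c d = RtoC 0.
Proof.
  assert (Hh : forall y, Cint (fun x => (x, y)) a b = ((b * b - a * a) / 2, (b - a) * y)).
  { intros y; apply Cint_unique.
    apply (is_RInt_fct_extend_pair (U := R_NormedModule) (V := R_NormedModule)); simpl.
    - apply is_RInt_idR.
    - apply (is_RInt_const (V := R_NormedModule)). }
  assert (Hv : forall x, Cint (fun y => (x, y)) c d = ((d - c) * x, (d * d - c * c) / 2)).
  { intros x; apply Cint_unique.
    apply (is_RInt_fct_extend_pair (U := R_NormedModule) (V := R_NormedModule)); simpl.
    - apply (is_RInt_const (V := R_NormedModule)).
    - apply is_RInt_idR. }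
  unfold rect_contour; rewrite !Hh, !Hv.
  unfold RtoC, Ci, Cminus, Cplus, Copp, Cmult; simpl; f_equal; field.
Qed.

(* If every rectangle violating [P] has a violating quarter, the quarters shrink to a
   point near which [P] fails for arbitrarily small rectangles. *)
Lemma bisection_ind (P : R -> R -> R -> R -> Prop) (a b c d : R) :
  a <= b -> c <= d ->
  (forall a b c d, P a b c d \/ ~ P a b c d) ->
  (forall a' b' c' d', a <= a' <= b' -> b' <= b -> c <= c' <= d' -> d' <= d ->
     P a' ((a' + b') / 2) c' ((c' + d') / 2) -> P ((a' + b') / 2) b' c' ((c' + d') / 2) ->
     P a' ((a' + b') / 2) ((c' + d') / 2) d' -> P ((a' + b') / 2) b' ((c' + d') / 2) d' ->
     P a' b' c' d') ->
  (forall x y, a <= x <= b -> c <= y <= d -> exists dl, 0 < dl /\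
     forall a' b' c' d', a <= a' -> b' <= b -> c <= c' -> d' <= d ->
       a' <= x <= b' -> c' <= y <= d'->
       b' - a' < dl -> d' - c' < dl -> P a' b' c' d') ->
  P a b c d.
Proof.
  intros Hab Hcd Pdec Hstep Hloc.
  destruct (Pdec a b c d) as [HP|HP]; [exact HP|exfalso].
  set (good := fun (n : nat) (r : R * R * (R * R)) =>
    let '((a', b'), (c', d')) := r in
    a <= a' <= b' /\ b' <= b /\ c <= c' <= d' /\ d' <= d /\
    b' - a' = (b - a) / 2 ^ n /\ d' - c' = (d - c) / 2 ^ n /\ ~ P a' b' c' d').
  set (sub := fun r r' : R * R * (R * R) =>
    let '((a', b'), (c', d')) := r in let '((a1, b1), (c1, d1)) := r' in
    a' <= a1 /\ b1 <= b' /\ c' <= c1 /\ d1 <= d').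
  assert (Hnext : forall n r, good n r -> exists r', good (S n) r' /\ sub r r').
  { intros n [[a' b'] [c' d']] (H1 & H2 & H3 & H4 & H5 & H6 & H7).
    assert (E : forall u, u / 2 ^ S n = u / 2 ^ n / 2).
    { intros u; simpl; field; apply pow_nonzero; lra. }
    set (m := (a' + b') / 2) in *; set (k := (c' + d') / 2) in *.
    assert (Hm : m - a' = (b - a) / 2 ^ S n /\ b' - m = (b - a) / 2 ^ S n)
      by (rewrite E, <- H5; unfold m; split; field).
    assert (Hk : k - c' = (d - c) / 2 ^ S n /\ d' - k = (d - c) / 2 ^ S n)
      by (rewrite E, <- H6; unfold k; split; field).
    assert (a' <= m <= b') by (unfold m; lra).
    assert (c' <= k <= d') by (unfold k; lra).
    destruct (Pdec a' m c' k); [|exists ((a', m), (c', k)); simpl; intuition lra].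
    destruct (Pdec m b' c' k); [|exists ((m, b'), (c', k)); simpl; intuition lra].
    destruct (Pdec a' m k d'); [|exists ((a', m), (k, d')); simpl; intuition lra].
    destruct (Pdec m b' k d'); [|exists ((m, b'), (k, d')); simpl; intuition lra].
    exfalso; apply H7; apply Hstep; assumption. }
  assert (Hseq : exists s, forall n, good n (s n) /\ sub (s n) (s (S n))).
  (* Dependent choice: each rectangle carries its own proof of [good], so that the recursion can
     continue. *)
  { assert (F : forall n (r : {r | good n r}), {r' : {r' | good (S n) r'} | sub (proj1_sig r) (proj1_sig r')}).
    { intros n [r Hr]; apply ClassicalEpsilon.constructive_indefinite_description.
      destruct (Hnext n r Hr) as [r' [Hr' Hs]]; now exists (exist _ r' Hr'). }
    assert (H0 : good 0%nat ((a, b), (c, d))) by (simpl; repeat split; try lra; assumption).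
    set (t := fix t n : {r | good n r} :=
      match n with O => exist _ _ H0 | S n => proj1_sig (F n (t n)) end).
    exists (fun n => proj1_sig (t n)); intros n; split; [apply (proj2_sig (t n))|].
    exact (proj2_sig (F n (t n))). }
  destruct Hseq as [s Hs].
  set (A := fun n => fst (fst (s n))); set (B := fun n => snd (fst (s n))).
  set (C := fun n => fst (snd (s n))); set (D := fun n => snd (snd (s n))).
  assert (Hg : forall n, a <= A n <= B n /\ B n <= b /\ c <= C n <= D n /\ D n <= d /\
    B n - A n = (b - a) / 2 ^ n /\ D n - C n = (d - c) / 2 ^ n /\ ~ P (A n) (B n) (C n) (D n)).
  { intros n; generalize (proj1 (Hs n)); unfold A, B, C, D.
    now destruct (s n) as [[a' b'] [c' d']]. }
  assert (Hn : forall n, A n <= A (S n) /\ B (S n) <= B n /\ C n <= C (S n) /\ D (S n) <= D n).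
  { intros n; generalize (proj2 (Hs n)); unfold A, B, C, D.
    now destruct (s n) as [[a' b'] [c' d']], (s (S n)) as [[a1 b1] [c1 d1]]. }
  assert (Hnest : forall U V : nat -> R, (forall n, U n <= V n) -> (forall n, U n <= U (S n)) ->
    (forall n, V (S n) <= V n) -> exists x, forall n, U n <= x <= V n).
  { intros U V HUV HU HV.
    assert (HUm : forall n k, U n <= U (n + k)%nat).
    { intros n k; induction k; [rewrite Nat.add_0_r; lra|].
      rewrite Nat.add_succ_r; eapply Rle_trans; [exact IHk|apply HU]. }
    assert (HVm : forall n k, V (n + k)%nat <= V n).
    { intros n k; induction k; [rewrite Nat.add_0_r; lra|].
      rewrite Nat.add_succ_r; eapply Rle_trans; [apply HV|exact IHk]. }
    assert (Hc : forall n k, U k <= V n).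
    { intros n k; apply Rle_trans with (U (k + n)%nat); [apply HUm|].
      apply Rle_trans with (V (k + n)%nat); [apply HUV|].
      rewrite Nat.add_comm; apply HVm. }
    (* The supremum of the left endpoints lies in every interval, as each right endpoint is an upper
       bound. *)
    destruct (completeness (fun x => exists n, x = U n)) as [x [Hx1 Hx2]].
    - exists (V O); intros x [n ->]; apply Hc.
    - exists (U O); now exists O.
    - exists x; intros n; split; [apply Hx1; now exists n|].
      apply Hx2; intros y [k ->]; apply Hc. }
  destruct (Hnest A B) as [x Hx]; [intros n; apply Hg|intros n; apply Hn|intros n; apply Hn|].
  destruct (Hnest C D) as [y Hy]; [intros n; apply Hg|intros n; apply Hn|intros n; apply Hn|].
  destruct (Hloc x y) as [dl [Hdl HPl]].
  - generalize (Hg O) (Hx O); lra.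
  - generalize (Hg O) (Hy O); lra.
  - assert (Hsmall : exists n, (b - a) / 2 ^ n < dl /\ (d - c) / 2 ^ n < dl).
    { set (M := (b - a) + (d - c) + 1).
      assert (HM : 0 < M) by (unfold M; lra).
      destruct (pow_lt_1_zero (/ 2)) with (y := dl / M) as [n Hn0].
      - rewrite Rabs_pos_eq; lra.
      - now apply Rdiv_lt_0_compat.
      - exists n; specialize (Hn0 n (le_n n)).
        rewrite Rabs_pos_eq in Hn0 by (apply pow_le; lra).
        rewrite pow_inv in Hn0.
        assert (Hp : 0 < / 2 ^ n) by (apply Rinv_0_lt_compat, pow_lt; lra).
        apply Rmult_lt_compat_l with (r := M) in Hn0; [|lra].
        replace (M * (dl / M)) with dl in Hn0 by (field; lra).
        unfold Rdiv; split; (eapply Rle_lt_trans; [|exact Hn0]);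
          (apply Rmult_le_compat_r; [lra|unfold M; lra]). }
    destruct Hsmall as [n [Hs1 Hs2]]; pose proof (Hg n) as Hgn.
    specialize (HPl (A n) (B n) (C n) (D n)).
    specialize (Hx n); specialize (Hy n); apply Hgn, HPl; lra.
Qed.

(** With [s] the sum of the two side lengths, the bisected claim is [|contour| <= 2 e s^2]. It
    passes from the quarters to the whole because [4 (s/2)^2 = s^2]. Near a point, the affine part
    of [f] integrates to zero and the rest is at most [e s] on a perimeter of [2 s]. *)
Theorem Goursat (f : C -> C) (a b c d : R) : a <= b -> c <= d ->
  on_rect (Cdiff f) a b c d -> rect_contour f a b c d = RtoC 0.
Proof.
  intros Hab Hcd H.
  assert (Hc : on_rect (Ccont f) a b c d) by (eapply on_rect_impl; [apply Cdiff_cont|exact H]).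
  set (L := (b - a) + (d - c)).
  apply Cmod_eq_0, Rle_antisym; [|apply Cmod_ge_0].
  apply le_epsilon; intros eps Heps; rewrite Rplus_0_l.
  (* Chosen so that [2 e L^2 <= eps]; the added 1 covers a rectangle reduced to a point. *)
  set (e := eps / (2 * (L * L + 1))).
  assert (He : 0 < e) by (apply Rdiv_lt_0_compat; nra).
  apply Rle_trans with (2 * e * (L * L)).
  2:{ apply Rle_trans with (e * (2 * (L * L + 1))); [nra|].
      right; unfold e; field; nra. }
  apply (bisection_ind (fun a' b' c' d' =>
    Cmod (rect_contour f a' b' c' d') <= 2 * e * (((b' - a') + (d' - c')) * ((b' - a') + (d' - c')))));
    [exact Hab|exact Hcd| | |].
  - intros; destruct (Rle_dec (Cmod (rect_contour f a0 b0 c0 d0)) (2 * e * ((b0 - a0 + (d0 - c0)) * (b0 - a0 + (d0 - c0)))));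
      [now left|now right].
  - intros a' b' c' d' Ha Hb Hc' Hd.
    set (m := (a' + b') / 2); set (k := (c' + d') / 2).
    assert (a' <= m <= b') by (unfold m; lra).
    assert (c' <= k <= d') by (unfold k; lra).
    assert (Hsub : on_rect (Ccont f) a' b' c' d') by (eapply on_rect_sub; [exact Hc|..]; lra).
    rewrite (rect_contour_split_v f a' m b' c' d') by (assumption || lra).
    rewrite (rect_contour_split_h f a' m c' k d'), (rect_contour_split_h f m b' c' k d')
      by (lra || (eapply on_rect_sub; [exact Hsub|..]; lra)).
    replace (m - a') with ((b' - a') / 2) by (unfold m; field).
    replace (b' - m) with ((b' - a') / 2) by (unfold m; field).
    replace (k - c') with ((d' - c') / 2) by (unfold k; field).
    replace (d' - k) with ((d' - c') / 2) by (unfold k; field).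
    intros.
    eapply Rle_trans; [apply Cmod_triangle|].
    pose proof (Cmod_triangle (rect_contour f a' m c' k) (rect_contour f a' m k d')).
    pose proof (Cmod_triangle (rect_contour f m b' c' k) (rect_contour f m b' k d')).
    nra.
  - intros x y Hx Hy; destruct (H x y Hx Hy) as [l Hl].
    (* Two sides below [dl / 2] keep the whole rectangle within distance [dl] of [(x, y)]. *)
    destruct (Hl e He) as [dl [Hdl Hw]]; exists (dl / 2); split; [lra|].
    intros a' b' c' d' Ha' Hb' Hc' Hd' Hx' Hy' Hs1 Hs2.
    set (g := fun w => (f w - f (x, y) - l * (w - (x, y)))%C).
    assert (Hsub : on_rect (Cdiff f) a' b' c' d') by (eapply on_rect_sub; [exact H|..]; lra).
    assert (Hlin : forall z, Cdiff (fun w => l * w)%C z) by (intros z; apply Cdiff_scal, Cdiff_id).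
    set (k := (f (x, y) - l * (x, y))%C).
    assert (Hg : on_rect (Ccont g) a' b' c' d').
    { intros u v Hu Hv; apply Cdiff_cont; unfold g.
      apply Cdiff_minus; [apply Cdiff_minus; [now apply Hsub|apply Cdiff_const]|].
      apply Cdiff_scal, Cdiff_minus; [apply Cdiff_id|apply Cdiff_const]. }
    assert (Hfr : forall h : C -> C, (forall z, Cdiff h z) -> on_boundary (Ccont h) a' b' c' d').
    { intros h Hh; apply on_rect_boundary; try lra; intros u v _ _; apply Cdiff_cont, Hh. }
    apply on_rect_boundary in Hg; try lra.
    assert (E : rect_contour f a' b' c' d' = rect_contour g a' b' c' d').
    { rewrite (rect_contour_ext f (fun w => g w + (l * w + k))%C)
        by (lra || (apply on_rect_boundary; try lra; intros u v _ _; unfold g, k; ring)).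
      rewrite rect_contour_plus; try lra; [|exact Hg|].
      - rewrite (rect_contour_plus (fun w => l * w)%C (fun _ => k)); try lra.
        + rewrite (rect_contour_scal l (fun w => w)); try lra.
          * rewrite rect_contour_id, rect_contour_const; ring.
          * apply Hfr, Cdiff_id.
        + apply Hfr, Hlin.
        + apply Hfr; intros z; apply Cdiff_const.
      - apply Hfr; intros z; apply Cdiff_plus; [apply Hlin|apply Cdiff_const]. }
    rewrite E; set (s := (b' - a') + (d' - c')).
    assert (Hb : forall u v, a' <= u <= b' -> c' <= v <= d' -> Cmod (g (u, v)) <= e * s).
    { intros u v Hu Hv.
      assert (Hd : Cmod ((u, v) - (x, y)) <= s).
      { replace ((u, v) - (x, y))%C with (u - x, v - y) by reflexivity.
        eapply Rle_trans; [apply Cmod_pair_le|].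
        assert (Rabs (u - x) <= b' - a') by (apply Rabs_le; lra).
        assert (Rabs (v - y) <= d' - c') by (apply Rabs_le; lra).
        unfold s; lra. }
      eapply Rle_trans; [apply Hw; unfold s in Hd; lra|].
      apply Rmult_le_compat_l; lra. }
    replace (2 * e * (s * s)) with (2 * s * (e * s)) by ring.
    apply rect_contour_bound; try lra; [exact Hg|].
    split; intros t Ht; split; apply Hb; lra.
Qed.

(** * Cauchy's formula and Taylor expansions *)

(** Sums leave equations typed in the carrier of a monoid; [ring] has to see the type C. *)
Ltac ceq := match goal with |- @eq _ ?a ?b => change (@eq C a b) end.

(* Only continuity along the edges is used: the integrand may be singular inside the
   inner rectangle. *)
Lemma rect_contour_hole (f : C -> C) (a a' b' b c c' d' d : R) :
  a <= a' -> a' <= b' -> b' <= b -> c <= c' -> c' <= d' -> d' <= d ->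
  on_boundary (Ccont f) a b c d ->
  on_rect (Ccont f) a a' c d -> on_rect (Ccont f) b' b c d ->
  rect_contour f a b c d = (rect_contour f a a' c d + rect_contour f b' b c d +
    rect_contour f a' b' c c' + rect_contour f a' b' d' d + rect_contour f a' b' c' d')%C.
Proof.
  intros Ha Hab Hb Hc Hcd Hd H H1 H2; boundary_segcont.
  assert (S1 : segcont (fun y => f (a', y)) c d) by (eapply segcont_v; [exact H1|lra]).
  assert (S2 : segcont (fun y => f (b', y)) c d) by (eapply segcont_v; [exact H2|lra]).
  assert (sub : forall g u v u' v', segcont g u v -> u <= u' -> v' <= v -> segcont g u' v')
    by (intros g u v u' v' Hg ? ? t Ht; apply Hg; lra).
  assert (Ch : forall g u v x y, segcont g u v -> u <= x -> x <= y -> y <= v ->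
    Cint g u v = (Cint g u x + Cint g x y + Cint g y v)%C).
  { intros g u v x y Hg Hux Hxy Hyv.
    rewrite (Cint_Chasles g u x v), (Cint_Chasles g x y v) by (lra || (eapply sub; [exact Hg| |]; lra)).
    ring. }
  unfold rect_contour.
  rewrite (Ch (fun x => f (x, c)) a b a' b'), (Ch (fun x => f (x, d)) a b a' b'),
    (Ch (fun y => f (a', y)) c d c' d'), (Ch (fun y => f (b', y)) c d c' d') by assumption.
  ring.
Qed.

(** On each side one coordinate of [1 / (w - s)] is odd about the midpoint and integrates to zero
    ([HA], through a logarithm), while the other gives [PI / 2] up to sign ([HB], through [atan]).
    Each of the four sides thus contributes [i PI / 2]. *)
Lemma rect_contour_inv (s : C) (r : R) : 0 < r ->
  rect_contour (fun w => / (w - s))%C (fst s - r) (fst s + r) (snd s - r) (snd s + r)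
  = (RtoC (2 * PI) * Ci)%C.
Proof.
  intros Hr; destruct s as [u v]; simpl.
  assert (Hp : forall t u, 0 < (t - u) ^ 2 + r ^ 2)
    by (intros t w; pose proof (pow2_ge_0 (t - w)); pose proof (pow_lt r 2 Hr); lra).
  assert (HB : forall u, is_RInt (V := R_NormedModule)
     (fun t => r / ((t - u) ^ 2 + r ^ 2)) (u - r) (u + r) (PI / 2)).
  { clear u v; intros u.
    replace (PI / 2) with (minus (atan ((u + r - u) / r)) (atan ((u - r - u) / r))).
    - apply (is_RInt_derive (V := R_CompleteNormedModule) (fun t => atan ((t - u) / r))).
      + intros t _; specialize (Hp t u); auto_derive; [lra|]; unfold Rsqr; field.
        repeat split; try lra; simpl in *; lra.
      + intros t _; specialize (Hp t u); apply (ex_derive_continuous (V := R_NormedModule)).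
        auto_derive; simpl in *; lra.
    - unfold minus, plus, opp; simpl.
      replace ((u + r - u) / r) with 1 by (field; lra).
      replace ((u - r - u) / r) with (- (1)) by (field; lra).
      rewrite atan_opp, atan_1; field. }
  assert (HA : forall u, is_RInt (V := R_NormedModule)
     (fun t => (t - u) / ((t - u) ^ 2 + r ^ 2)) (u - r) (u + r) 0).
  { clear u v; intros u.
    replace 0 with (minus (ln ((u + r - u) ^ 2 + r ^ 2) / 2) (ln ((u - r - u) ^ 2 + r ^ 2) / 2)).
    - apply (is_RInt_derive (V := R_CompleteNormedModule) (fun t => ln ((t - u) ^ 2 + r ^ 2) / 2)).
      + intros t _; specialize (Hp t u); auto_derive; [simpl in *; lra|]; field; simpl in *; lra.
      + intros t _; specialize (Hp t u); apply (ex_derive_continuous (V := R_NormedModule)).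
        auto_derive; simpl in *; lra.
    - unfold minus, plus, opp; simpl.
      replace (u - r - u) with (- (u + r - u)) by ring.
      replace (- (u + r - u) * (- (u + r - u) * 1)) with ((u + r - u) * ((u + r - u) * 1)) by ring.
      ring. }
  unfold rect_contour.
  assert (Hinv : forall x y : R, x <> 0 \/ y <> 0 ->
    (/ (x, y))%C = (x / (x ^ 2 + y ^ 2), - y / (x ^ 2 + y ^ 2))) by (intros; reflexivity).
  assert (E1 : Cint (fun x => / ((x, (v - r)%R) - (u, v)))%C (u - r) (u + r) = (0, PI / 2)).
  { apply Cint_unique, (is_RInt_fct_extend_pair (U := R_NormedModule) (V := R_NormedModule)).
    - eapply is_RInt_ext; [|apply HA]; intros t _; simpl; f_equal; f_equal; ring.
    - eapply is_RInt_ext; [|apply HB]; intros t _; simpl; unfold Rdiv; (f_equal; try ring; f_equal; ring). }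
  assert (E2 : Cint (fun x => / ((x, (v + r)%R) - (u, v)))%C (u - r) (u + r) = (0, - (PI / 2))).
  { apply Cint_unique, (is_RInt_fct_extend_pair (U := R_NormedModule) (V := R_NormedModule)).
    - eapply is_RInt_ext; [|apply HA]; intros t _; simpl; f_equal; f_equal; ring.
    - eapply is_RInt_ext; [|apply (is_RInt_opp (V := R_NormedModule)), HB].
      intros t _; unfold opp; simpl; unfold Rdiv.
      rewrite Ropp_mult_distr_l; (f_equal; try ring; f_equal; ring). }
  assert (E3 : Cint (fun y => / (((u + r)%R, y) - (u, v)))%C (v - r) (v + r) = (PI / 2, - 0)).
  { apply Cint_unique, (is_RInt_fct_extend_pair (U := R_NormedModule) (V := R_NormedModule)).
    - eapply is_RInt_ext; [|apply HB]; intros t _; simpl; unfold Rdiv; (f_equal; try ring; f_equal; ring).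
    - eapply is_RInt_ext; [|apply (is_RInt_opp (V := R_NormedModule)), HA].
      intros t _; unfold opp; simpl; unfold Rdiv.
      rewrite Ropp_mult_distr_l; (f_equal; try ring; f_equal; ring). }
  assert (E4 : Cint (fun y => / (((u - r)%R, y) - (u, v)))%C (v - r) (v + r) = (- (PI / 2), - 0)).
  { apply Cint_unique, (is_RInt_fct_extend_pair (U := R_NormedModule) (V := R_NormedModule)).
    - eapply is_RInt_ext; [|apply (is_RInt_opp (V := R_NormedModule)), HB].
      intros t _; unfold opp; simpl; unfold Rdiv.
      rewrite Ropp_mult_distr_l; (f_equal; try ring; f_equal; ring).
    - eapply is_RInt_ext; [|apply (is_RInt_opp (V := R_NormedModule)), HA].
      intros t _; unfold opp; simpl; unfold Rdiv.
      rewrite Ropp_mult_distr_l; (f_equal; try ring; f_equal; ring). }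
  rewrite E1, E2, E3, E4.
  unfold RtoC, Ci, Cminus, Cplus, Copp, Cmult; simpl; f_equal; field.
Qed.

Definition square (z0 : C) (rho : R) (P : C -> Prop) : Prop :=
  on_rect P (fst z0 - rho) (fst z0 + rho) (snd z0 - rho) (snd z0 + rho).

Definition square_contour (z0 : C) (rho : R) (f : C -> C) : C :=
  rect_contour f (fst z0 - rho) (fst z0 + rho) (snd z0 - rho) (snd z0 + rho).

(** Supplies the lower bound for the denominators [w - z0] on the contour: one coordinate of
    [w - z0] is [rho] or [- rho]. *)
Lemma boundary_Cmod (z0 : C) (rho : R) : 0 < rho ->
  on_boundary (fun w => rho <= Cmod (w - z0))
    (fst z0 - rho) (fst z0 + rho) (snd z0 - rho) (snd z0 + rho).
Proof.
  intros Hr; destruct z0 as [u v]; simpl.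
  split; intros t Ht; split.
  - eapply Rle_trans; [|apply (snd_le_Cmod ((t, (v - rho)%R) - (u, v)))]; simpl.
    rewrite <- Rabs_Ropp, Rabs_pos_eq; lra.
  - eapply Rle_trans; [|apply (snd_le_Cmod ((t, (v + rho)%R) - (u, v)))]; simpl.
    rewrite Rabs_pos_eq; lra.
  - eapply Rle_trans; [|apply (fst_le_Cmod (((u - rho)%R, t) - (u, v)))]; simpl.
    rewrite <- Rabs_Ropp, Rabs_pos_eq; lra.
  - eapply Rle_trans; [|apply (fst_le_Cmod (((u + rho)%R, t) - (u, v)))]; simpl.
    rewrite Rabs_pos_eq; lra.
Qed.

Lemma on_boundary_and (P Q : C -> Prop) (a b c d : R) :
  on_boundary P a b c d -> on_boundary Q a b c d -> on_boundary (fun z => P z /\ Q z) a b c d.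
Proof.
  intros [H1 H2] [H3 H4]; split; intros t Ht; split; split;
    (apply H1 || apply H2 || apply H3 || apply H4); exact Ht.
Qed.

Lemma on_boundary_impl (P Q : C -> Prop) (a b c d : R) :
  (forall z, P z -> Q z) -> on_boundary P a b c d -> on_boundary Q a b c d.
Proof. intros PQ [H1 H2]; split; intros t Ht; split; apply PQ; (apply H1 || apply H2); exact Ht. Qed.

Lemma Cmod_pos_neq (z w : C) : 0 < Cmod (z - w) -> (z - w)%C <> RtoC 0.
Proof. intros H; now apply Cmod_gt_0. Qed.

(** By Goursat on the four surrounding rectangles the contour shrinks to a square of half-side [r]
    about [s]. There [f w - f s] is below [eps / 8], [1 / |w - s|] is at most [1 / r], and the
    perimeter is [8 r]; what remains is [f s] times the integral of [1 / (w - s)]. *)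
Theorem Cauchy_formula (f : C -> C) (z0 s : C) (rho : R) :
  square z0 rho (Cdiff f) -> Cmod (s - z0) < rho ->
  square_contour z0 rho (fun w => f w / (w - s))%C = (RtoC (2 * PI) * Ci * f s)%C.
Proof.
  intros Hf Hs; assert (Hrho : 0 < rho) by (pose proof (Cmod_ge_0 (s - z0)); lra).
  set (g := fun w => (f w / (w - s))%C).
  pose proof (fst_le_Cmod (s - z0)) as Hre; pose proof (snd_le_Cmod (s - z0)) as Him.
  destruct z0 as [x0 y0]; destruct s as [u v]; unfold square, square_contour in *; simpl in *.
  apply Rabs_le_between in Hre; apply Rabs_le_between in Him.
  (* A square about [s] of half-side less than [m] lies inside the given one. *)
  set (m := rho - Cmod ((u, v) - (x0, y0))) in *.
  assert (Hm : 0 < m) by (unfold m; lra).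
  set (a := x0 - rho) in *; set (b := x0 + rho) in *; set (c := y0 - rho) in *; set (d := y0 + rho) in *.
  assert (Hin : a <= u <= b /\ c <= v <= d) by (unfold a, b, c, d; lra).
  assert (Hg : forall x y, a <= x <= b -> c <= y <= d -> x <> u \/ y <> v -> Cdiff g (x, y)).
  { intros x y Hx Hy Hne; unfold g; apply Cdiff_div.
    - now apply Hf.
    - apply Cdiff_minus; [apply Cdiff_id|apply Cdiff_const].
    - intros E; apply (f_equal fst) in E as E1; apply (f_equal snd) in E as E2; simpl in E1, E2; lra. }
  assert (HgR : forall r, 0 < r -> r < m -> rect_contour g a b c d = rect_contour g (u - r) (u + r) (v - r) (v + r)).
  { intros r Hr0 Hr.
    rewrite (rect_contour_hole g a (u - r) (u + r) b c (v - r) (v + r) d);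
      try (unfold a, b, c, d, m in *; lra).
    - rewrite (Goursat g a (u - r) c d), (Goursat g (u + r) b c d),
        (Goursat g (u - r) (u + r) c (v - r)), (Goursat g (u - r) (u + r) (v + r) d);
        [ring|..]; try (unfold a, b, c, d, m in *; lra);
        intros x y Hx Hy; apply Hg; unfold a, b, c, d, m in *; lra.
    - split; intros t Ht; split; apply Cdiff_cont, Hg; unfold a, b, c, d, m in *; lra.
    - intros x y Hx Hy; apply Cdiff_cont, Hg; unfold a, b, c, d, m in *; lra.
    - intros x y Hx Hy; apply Cdiff_cont, Hg; unfold a, b, c, d, m in *; lra. }
  apply Ceq_minus, Cmod_eq_0, Rle_antisym; [|apply Cmod_ge_0].
  apply le_epsilon; intros eps Heps; rewrite Rplus_0_l.
  assert (Hcf : Ccont f (u, v)) by (apply Cdiff_cont, Hf; apply Hin).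
  destruct (Hcf (eps / 8)) as [dl [Hdl Hc]]; [lra|].
  (* Points of the small square are within [2 r < dl] of [s]. *)
  set (r := Rmin (dl / 4) (m / 2)).
  assert (Hr : 0 < r /\ r <= dl / 4 /\ r <= m / 2).
  { unfold r; repeat split; [apply Rmin_glb_lt; lra|apply Rmin_l|apply Rmin_r]. }
  rewrite (HgR r) by lra.
  pose proof (rect_contour_inv (u, v) r (proj1 Hr)) as Hinv; simpl in Hinv.
  pose proof (boundary_Cmod (u, v) r (proj1 Hr)) as Hfr; simpl in Hfr.
  set (a' := u - r) in *; set (b' := u + r) in *; set (c' := v - r) in *; set (d' := v + r) in *.
  assert (Hab' : a' <= b' /\ c' <= d') by (unfold a', b', c', d'; lra).
  set (h := fun w => (g w + (- f (u, v)) * / (w - (u, v)))%C).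
  assert (Ki : on_boundary (Ccont (fun w => / (w - (u, v)))%C) a' b' c' d').
  { eapply on_boundary_impl; [|exact Hfr]; intros z Hz; apply Cdiff_cont.
    apply (Cdiff_comp Cinv (fun w => w - (u, v))%C);
      [apply Cdiff_minus; [apply Cdiff_id|apply Cdiff_const]|].
    apply Cdiff_inv, Cmod_pos_neq; lra. }
  assert (Kk : on_boundary (Ccont (fun w => (- f (u, v)) * / (w - (u, v)))%C) a' b' c' d').
  { eapply on_boundary_impl; [|exact Hfr]; intros z Hz; apply Cdiff_cont, Cdiff_scal.
    apply (Cdiff_comp Cinv (fun w => w - (u, v))%C);
      [apply Cdiff_minus; [apply Cdiff_id|apply Cdiff_const]|].
    apply Cdiff_inv, Cmod_pos_neq; lra. }
  assert (Kg : on_boundary (Ccont g) a' b' c' d').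
  { split; intros t Ht; split; apply Cdiff_cont, Hg;
      unfold a', b', c', d', a, b, c, d, m in *; lra. }
  assert (Kh : on_boundary (Ccont h) a' b' c' d').
  { assert (Hgh : forall x y, a <= x <= b -> c <= y <= d -> x <> u \/ y <> v -> Ccont h (x, y)).
    { intros x y Hx Hy Hne; apply Cdiff_cont, Cdiff_plus; [now apply Hg|].
      apply Cdiff_scal, (Cdiff_comp Cinv (fun w => w - (u, v))%C);
        [apply Cdiff_minus; [apply Cdiff_id|apply Cdiff_const]|].
      apply Cdiff_inv; intros E; apply (f_equal fst) in E as E1; apply (f_equal snd) in E as E2;
        simpl in E1, E2; lra. }
    split; intros t Ht; split; apply Hgh;
      unfold a', b', c', d', a, b, c, d, m in *; lra. }
  assert (E : rect_contour h a' b' c' d' = (rect_contour g a' b' c' d' - RtoC (2 * PI) * Ci * f (u, v))%C).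
  { unfold h; rewrite rect_contour_plus, rect_contour_scal; try tauto.
    rewrite Hinv; ring. }
  rewrite <- E.
  apply Rle_trans with (2 * ((b' - a') + (d' - c')) * (eps / 8 / r)).
  2:{ right; unfold a', b', c', d'; field; lra. }
  apply rect_contour_bound; try tauto.
  assert (Hnear : on_boundary (fun w => Cmod (w - (u, v)) < dl) a' b' c' d').
  { assert (Hn : forall x y, a' <= x <= b' -> c' <= y <= d' -> Cmod ((x, y) - (u, v)) < dl).
    { intros x y Hx Hy; replace ((x, y) - (u, v))%C with (x - u, y - v) by reflexivity.
      eapply Rle_lt_trans; [apply Cmod_pair_le|].
      assert (Rabs (x - u) <= r) by (apply Rabs_le; unfold a', b' in *; lra).
      assert (Rabs (y - v) <= r) by (apply Rabs_le; unfold c', d' in *; lra).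
      lra. }
    apply on_rect_boundary; try tauto; exact Hn. }
  eapply on_boundary_impl; [|exact (on_boundary_and _ _ _ _ _ _ Hfr Hnear)].
  intros z [Hz1 Hz2]; unfold h, g.
  replace (f z / (z - (u, v)) + - f (u, v) * / (z - (u, v)))%C with
    ((f z - f (u, v)) * / (z - (u, v)))%C by (unfold Cdiv; ring).
  rewrite Cmod_mult, Cmod_inv by (apply Cmod_pos_neq; lra).
  specialize (Hc z Hz2).
  apply Rmult_le_compat; [apply Cmod_ge_0|apply Rlt_le, Rinv_0_lt_compat; lra|lra|].
  apply Rinv_le_contravar; lra.
Qed.

Lemma is_series_C_eps (a : nat -> C) (l : C) :
  is_series (K := C_AbsRing) (V := C_NormedModule) a l <->
  forall eps, 0 < eps -> exists N, forall n, (N <= n)%nat ->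
    Cmod (sum_n (G := C_AbelianMonoid) a n - l) < eps.
Proof.
  split.
  - intros H eps Heps.
    (* Balls of the product structure bound only the two coordinates, hence the halving. *)
    assert (He : 0 < eps / 2) by lra.
    destruct (proj1 (filterlim_locally _ _) H (mkposreal _ He)) as [N HN].
    exists N; intros n Hn; destruct (HN n Hn) as [H1 H2].
    set (u := (sum_n (G := C_AbelianMonoid) a n - l)%C).
    change (Rabs (fst u) < eps / 2) in H1; change (Rabs (snd u) < eps / 2) in H2.
    rewrite (surjective_pairing u); pose proof (Cmod_pair_le (fst u) (snd u)); lra.
  - intros H; apply filterlim_locally; intros eps.
    destruct (H eps (cond_pos eps)) as [N HN]; exists N; intros n Hn.
    specialize (HN n Hn); split.
    + eapply Rle_lt_trans; [|exact HN]; apply (fst_le_Cmod (sum_n a n - l)).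
    + eapply Rle_lt_trans; [|exact HN]; apply (snd_le_Cmod (sum_n a n - l)).
Qed.

Lemma pathcont_bounded (f : R -> C) (a b : R) : segcont f a b ->
  exists M, forall t, a <= t <= b -> Cmod (f t) <= M.
Proof.
  intros H; destruct (bounded_continuity (V := C_R_NormedModule) f a b H) as [M HM].
  exists M; intros t Ht; rewrite <- norm_C_R; now apply Rlt_le, HM.
Qed.

Lemma boundary_bounded (f : C -> C) (a b c d : R) : on_boundary (Ccont f) a b c d ->
  exists M, on_boundary (fun w => Cmod (f w) <= M) a b c d.
Proof.
  intros H; boundary_segcont.
  destruct (pathcont_bounded _ _ _ H0) as [M1 HM1].
  destruct (pathcont_bounded _ _ _ H1) as [M2 HM2].
  destruct (pathcont_bounded _ _ _ H2) as [M3 HM3].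
  destruct (pathcont_bounded _ _ _ H3) as [M4 HM4].
  pose proof (Rmax_l (Rmax M1 M2) (Rmax M3 M4)); pose proof (Rmax_r (Rmax M1 M2) (Rmax M3 M4)).
  pose proof (Rmax_l M1 M2); pose proof (Rmax_r M1 M2).
  pose proof (Rmax_l M3 M4); pose proof (Rmax_r M3 M4).
  exists (Rmax (Rmax M1 M2) (Rmax M3 M4)); split; intros t Ht; split;
    (eapply Rle_trans; [(apply HM1 || apply HM2 || apply HM3 || apply HM4); exact Ht|lra]).
Qed.

Lemma two_pi_i_neq0 : (RtoC (2 * PI) * Ci)%C <> RtoC 0.
Proof.
  apply Cmult_neq_0; [|apply Ci_nz].
  intros E; apply RtoC_inj in E; pose proof PI_RGT_0; lra.
Qed.

Lemma Cmod_two_pi_i : Cmod (RtoC (2 * PI) * Ci) = 2 * PI.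
Proof.
  rewrite Cmod_mult, Cmod_Ci, Cmod_R, Rabs_pos_eq; [ring|].
  pose proof PI_RGT_0; lra.
Qed.

Lemma geom_small (K theta eps : R) : 0 <= theta < 1 -> 0 < eps ->
  exists N, forall n, (N <= n)%nat -> K * theta ^ n < eps.
Proof.
  intros Ht He.
  destruct (pow_lt_1_zero theta) with (y := eps / (Rabs K + 1)) as [N HN].
  - rewrite Rabs_pos_eq; lra.
  - apply Rdiv_lt_0_compat; [lra|pose proof (Rabs_pos K); lra].
  - exists N; intros n Hn; specialize (HN n Hn).
    pose proof (Rabs_pos K); pose proof (Rle_abs K).
    assert (0 <= theta ^ n) by (apply pow_le; lra).
    rewrite Rabs_pos_eq in HN by lra.
    apply Rlt_div_r in HN; [|lra]. nra.
Qed.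

(** The coefficients are an arbitrary sequence, so no higher derivative is ever formed; their
    uniqueness is a separate lemma. *)
Definition has_taylor (f : C -> C) (z0 : C) (rho : R) (c : nat -> C) : Prop :=
  forall s, Cmod (s - z0) < rho ->
    is_series (K := C_AbsRing) (V := C_NormedModule)
      (fun m => c m * Cpow (s - z0) m)%C (f s).

(** The coefficients are Cauchy's integrals of [f w / (w - z0)^(m+1)], and the expansion of
    [1 / (w - s)] in a finite geometric sum gives the series with a remainder. The constant 2 in the
    bound is a rounding of [8 / (2 PI)], since the perimeter is [8 rho] instead of [2 PI rho]. *)
Theorem Taylor_square (f : C -> C) (z0 : C) (rho : R) :
  0 < rho -> square z0 rho (Cdiff f) ->
  exists c, has_taylor f z0 rho c /\
    forall M, square z0 rho (fun w => Cmod (f w) <= M) ->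
      forall m, Cmod (c m) <= 2 * M / rho ^ m.
Proof.
  intros Hrho Hf.
  set (k := (RtoC (2 * PI) * Ci)%C).
  pose proof two_pi_i_neq0 as Hk; fold k in Hk.
  set (q := fun m w => (f w / Cpow (w - z0) (S m))%C).
  assert (Hle : fst z0 - rho <= fst z0 + rho /\ snd z0 - rho <= snd z0 + rho) by lra.
  pose proof (boundary_Cmod z0 rho Hrho) as Hfr.
  assert (Hff : on_boundary (Cdiff f) (fst z0 - rho) (fst z0 + rho) (snd z0 - rho) (snd z0 + rho))
    by (apply on_rect_boundary; tauto).
  assert (Hpow : forall m w, Cdiff (fun w => Cpow (w - z0) m) w)
    by (intros m w; apply Cdiff_pow, Cdiff_minus; [apply Cdiff_id|apply Cdiff_const]).
  assert (Kq : forall m, on_boundary (Ccont (q m))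
    (fst z0 - rho) (fst z0 + rho) (snd z0 - rho) (snd z0 + rho)).
  { intros m; eapply on_boundary_impl; [|exact (on_boundary_and _ _ _ _ _ _ Hfr Hff)].
    intros z [Hz1 Hz2]; apply Cdiff_cont, Cdiff_div; [exact Hz2|apply Hpow|].
    apply Cpow_nz, Cmod_pos_neq; lra. }
  exists (fun m => / k * square_contour z0 rho (q m))%C; split.
  - intros s Hs.
    (* The integrand of the remainder after [n] terms of the geometric expansion. *)
    set (R := fun n w => (f w / (w - s) * Cpow ((s - z0) / (w - z0)) n)%C).
    assert (Hws : on_boundary (fun w => rho - Cmod (s - z0) <= Cmod (w - s))
       (fst z0 - rho) (fst z0 + rho) (snd z0 - rho) (snd z0 + rho)).
    { eapply on_boundary_impl; [|exact Hfr]; intros w Hw.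
      pose proof (Cmod_minus_triangle w s z0); lra. }
    assert (KR : forall n, on_boundary (Ccont (R n))
      (fst z0 - rho) (fst z0 + rho) (snd z0 - rho) (snd z0 + rho)).
    { intros n; eapply on_boundary_impl;
        [|exact (on_boundary_and _ _ _ _ _ _ (on_boundary_and _ _ _ _ _ _ Hfr Hff) Hws)].
      intros z [[Hz1 Hz2] Hz3]; apply Cdiff_cont, Cdiff_mult.
      - apply Cdiff_div; [exact Hz2| |apply Cmod_pos_neq; lra].
        apply Cdiff_minus; [apply Cdiff_id|apply Cdiff_const].
      - apply Cdiff_pow, Cdiff_div; [apply Cdiff_const| |apply Cmod_pos_neq; lra].
        apply Cdiff_minus; [apply Cdiff_id|apply Cdiff_const]. }
    (* With [t = (s - z0) / (w - z0)]: [t^n / (w - s) = (s - z0)^n / (w - z0)^(n+1) + t^(n+1) / (w -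
       s)]. *)
    assert (Hstep : forall n, square_contour z0 rho (R n) =
      (Cpow (s - z0) n * square_contour z0 rho (q n) + square_contour z0 rho (R (S n)))%C).
    { intros n; unfold square_contour; rewrite <- rect_contour_scal by (tauto || apply Kq).
      rewrite <- rect_contour_plus; try tauto; [| |apply KR].
      - apply rect_contour_ext; try tauto.
        eapply on_boundary_impl; [|exact (on_boundary_and _ _ _ _ _ _ Hfr Hws)].
        intros w [H1 H2]; unfold R, q.
        assert ((w - z0)%C <> RtoC 0) by (apply Cmod_pos_neq; lra).
        assert ((w - s)%C <> RtoC 0) by (apply Cmod_pos_neq; lra).
        unfold Cdiv; rewrite !Cpow_mult_l, !Cpow_inv, !Cpow_S by assumption.
        assert (Cpow (w - z0) n <> RtoC 0) by now apply Cpow_nz.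
        field; tauto.
      - eapply on_boundary_impl; [|exact (on_boundary_and _ _ _ _ _ _ Hfr Hff)].
        intros z [Hz1 Hz2]; apply Cdiff_cont, Cdiff_scal, Cdiff_div; [exact Hz2|apply Hpow|].
        apply Cpow_nz, Cmod_pos_neq; lra. }
    assert (Hsum : forall n, sum_n (G := C_AbelianMonoid)
       (fun m => / k * square_contour z0 rho (q m) * Cpow (s - z0) m)%C n =
       (f s - / k * square_contour z0 rho (R (S n)))%C).
    { assert (H0 : square_contour z0 rho (R 0%nat) = (k * f s)%C).
      { unfold k; rewrite <- (Cauchy_formula f z0 s rho Hf Hs).
        unfold square_contour; apply rect_contour_ext; try tauto.
        apply on_rect_boundary; try tauto; intros x y _ _; unfold R; simpl; ring. }
      induction n as [|n IH].
      - rewrite sum_O.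
        replace (f s) with (/ k * square_contour z0 rho (R 0%nat))%C by (rewrite H0; field; exact Hk).
        rewrite (Hstep 0%nat); ceq; ring.
      - rewrite sum_Sn, IH; rewrite (Hstep (S n)).
        change (@plus C_AbelianMonoid) with Cplus; ceq; ring. }
    destruct (boundary_bounded _ _ _ _ _ (on_boundary_impl _ _ _ _ _ _ (Cdiff_cont f) Hff)) as [M HM].
    set (e := rho - Cmod (s - z0)) in *; assert (He : 0 < e) by (unfold e; lra).
    set (th := Cmod (s - z0) / rho).
    assert (Hth : 0 <= th < 1).
    { unfold th; split; [apply Rdiv_le_0_compat; [apply Cmod_ge_0|lra]|].
      apply Rlt_div_l; lra. }
    apply is_series_C_eps; intros eps Heps.
    destruct (geom_small (/ (2 * PI) * (2 * (2 * rho + 2 * rho) * (M / e))) th eps Hth Heps) as [N HN].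
    exists N; intros n Hn; rewrite Hsum.
    replace (f s - / k * square_contour z0 rho (R (S n)) - f s)%C with
      (- (/ k * square_contour z0 rho (R (S n))))%C by ring.
    rewrite Cmod_opp, Cmod_mult, Cmod_inv by exact Hk.
    unfold k at 1; rewrite Cmod_two_pi_i.
    eapply Rle_lt_trans; [|apply (HN (S n)); lia].
    rewrite Rmult_assoc; apply Rmult_le_compat_l.
    { apply Rlt_le, Rinv_0_lt_compat; pose proof PI_RGT_0; lra. }
    rewrite Rmult_assoc; unfold square_contour.
    replace (2 * rho) with (fst z0 + rho - (fst z0 - rho)) at 1 by ring.
    replace (2 * rho) with (snd z0 + rho - (snd z0 - rho)) at 1 by ring.
    apply rect_contour_bound; try tauto; [apply KR|].
    eapply on_boundary_impl;
      [|exact (on_boundary_and _ _ _ _ _ _ (on_boundary_and _ _ _ _ _ _ Hfr HM) Hws)].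
    intros w [[H1 H2] H3]; unfold R.
    rewrite Cmod_mult, Cmod_pow, !Cmod_div by (apply Cmod_pos_neq; lra).
    apply Rmult_le_compat.
    + apply Rdiv_le_0_compat; [apply Cmod_ge_0|lra].
    + apply pow_le, Rdiv_le_0_compat; [apply Cmod_ge_0|lra].
    + apply Rmult_le_compat; [apply Cmod_ge_0|apply Rlt_le, Rinv_0_lt_compat; lra|lra|].
      apply Rinv_le_contravar; lra.
    + apply pow_incr; split; [apply Rdiv_le_0_compat; [apply Cmod_ge_0|lra]|].
      apply Rmult_le_compat_l; [apply Cmod_ge_0|apply Rinv_le_contravar; lra].
  - intros M HM m.
    rewrite Cmod_mult, Cmod_inv by exact Hk; unfold k; rewrite Cmod_two_pi_i.
    assert (Hp : 0 < rho ^ m) by (apply pow_lt; lra).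
    assert (HM0 : 0 <= M).
    { eapply Rle_trans; [apply Cmod_ge_0|apply (HM (fst z0) (snd z0)); lra]. }
    assert (Hb : Cmod (square_contour z0 rho (q m)) <= 2 * (2 * rho + 2 * rho) * (M / rho ^ S m)).
    { unfold square_contour.
      replace (2 * rho) with (fst z0 + rho - (fst z0 - rho)) at 1 by ring.
      replace (2 * rho) with (snd z0 + rho - (snd z0 - rho)) at 1 by ring.
      apply rect_contour_bound; try tauto; [apply Kq|].
      apply on_rect_boundary in HM; try tauto.
      eapply on_boundary_impl; [|exact (on_boundary_and _ _ _ _ _ _ Hfr HM)].
      intros w [H1 H2]; unfold q.
      rewrite Cmod_div, Cmod_pow by (apply Cpow_nz, Cmod_pos_neq; lra).
      assert (0 < rho ^ S m) by (apply pow_lt; lra).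
      assert (rho ^ S m <= Cmod (w - z0) ^ S m) by (apply pow_incr; lra).
      apply Rmult_le_compat; [apply Cmod_ge_0|apply Rlt_le, Rinv_0_lt_compat; lra|lra|].
      apply Rinv_le_contravar; lra. }
    assert (Hpi : 2 < PI) by (pose proof PI2_1; lra).
    apply Rle_trans with (/ (2 * PI) * (2 * (2 * rho + 2 * rho) * (M / rho ^ S m))).
    { apply Rmult_le_compat_l; [apply Rlt_le, Rinv_0_lt_compat; lra|exact Hb]. }
    replace (/ (2 * PI) * (2 * (2 * rho + 2 * rho) * (M / rho ^ S m)))
      with (4 / PI * (M / rho ^ m)) by (simpl; field; lra).
    replace (2 * M / rho ^ m) with (2 * (M / rho ^ m)) by (field; lra).
    apply Rmult_le_compat_r; [apply Rdiv_le_0_compat; lra|].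
    apply Rle_div_l; lra.
Qed.

(** * Uniqueness of power series coefficients *)

Lemma sum_n_fst (a : nat -> C) (n : nat) :
  fst (sum_n (G := C_AbelianMonoid) a n) = sum_n (fun k => fst (a k)) n.
Proof. induction n; [now rewrite !sum_O|]. rewrite !sum_Sn, <- IHn; reflexivity. Qed.

Lemma sum_n_snd (a : nat -> C) (n : nat) :
  snd (sum_n (G := C_AbelianMonoid) a n) = sum_n (fun k => snd (a k)) n.
Proof. induction n; [now rewrite !sum_O|]. rewrite !sum_Sn, <- IHn; reflexivity. Qed.

Lemma is_series_Re_Im (a : nat -> C) (l : C) :
  is_series (K := C_AbsRing) (V := C_NormedModule) a l ->
  is_series (fun k => fst (a k)) (fst l) /\ is_series (fun k => snd (a k)) (snd l).
Proof.
  intros H; split.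
  - change (is_lim_seq (sum_n (fun k => fst (a k))) (fst l)); apply is_lim_seq_spec; intros eps.
    destruct (proj1 (is_series_C_eps a l) H eps (cond_pos eps)) as [N HN].
    exists N; intros n Hn; specialize (HN n Hn); rewrite <- sum_n_fst.
    eapply Rle_lt_trans; [|exact HN]; apply (fst_le_Cmod (sum_n a n - l)).
  - change (is_lim_seq (sum_n (fun k => snd (a k))) (snd l)); apply is_lim_seq_spec; intros eps.
    destruct (proj1 (is_series_C_eps a l) H eps (cond_pos eps)) as [N HN].
    exists N; intros n Hn; specialize (HN n Hn); rewrite <- sum_n_snd.
    eapply Rle_lt_trans; [|exact HN]; apply (snd_le_Cmod (sum_n a n - l)).
Qed.

(** Beyond the radius of convergence the terms would not tend to zero. *)
Lemma ex_pseries_radius (a : nat -> R) (d : R) : 0 < d -> ex_pseries a d ->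
  Rbar_lt 0 (CV_radius a).
Proof.
  intros Hd H; apply Rbar_lt_le_trans with d; [exact Hd|].
  apply Rbar_not_lt_le; intros Hlt.
  apply (CV_disk_outside a d).
  - now rewrite Rabs_pos_eq by lra.
  - now apply ex_series_lim_0, ex_pseries_R.
Qed.

Lemma pseries_coef_unique (a b : nat -> R) (F : R -> R) (d : R) : 0 < d ->
  (forall x, Rabs x < d -> is_series (fun m => a m * x ^ m) (F x)) ->
  (forall x, Rabs x < d -> is_series (fun m => b m * x ^ m) (F x)) ->
  forall m, a m = b m.
Proof.
  intros Hd Ha Hb m.
  assert (Hd2 : Rabs (d / 2) < d) by (rewrite Rabs_pos_eq; lra).
  apply PSeries_ext_recip.
  - apply (ex_pseries_radius a (d / 2)); [lra|].
    apply ex_pseries_R; eexists; now apply Ha.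
  - apply (ex_pseries_radius b (d / 2)); [lra|].
    apply ex_pseries_R; eexists; now apply Hb.
  - exists (mkposreal d Hd); intros x Hx.
    assert (Hx' : Rabs x < d).
    { replace x with (minus x 0) by (unfold minus, plus, opp; simpl; ring); exact Hx. }
    rewrite (is_pseries_unique a x (F x)), (is_pseries_unique b x (F x)); [reflexivity|..];
      apply is_pseries_R; auto.
Qed.

Lemma Cpow_R (x : R) (m : nat) : Cpow (RtoC x) m = RtoC (x ^ m).
Proof. symmetry; apply RtoC_pow. Qed.

(** For real [x] the real and imaginary parts are real power series, so real uniqueness applies to
    each. Asking for real [x] only is what later allows a comparison with expansions known just on
    the real axis. *)
Lemma Cseries_coef_unique (a b : nat -> C) (F : R -> C) (d : R) : 0 < d ->
  (forall x, Rabs x < d -> is_series (K := C_AbsRing) (V := C_NormedModule)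
     (fun m => a m * RtoC (x ^ m))%C (F x)) ->
  (forall x, Rabs x < d -> is_series (K := C_AbsRing) (V := C_NormedModule)
     (fun m => b m * RtoC (x ^ m))%C (F x)) ->
  forall m, a m = b m.
Proof.
  intros Hd Ha Hb m.
  assert (E : forall (c : nat -> C) x, (forall m, fst (c m * RtoC (x ^ m))%C = fst (c m) * x ^ m) /\
     forall m, snd (c m * RtoC (x ^ m))%C = snd (c m) * x ^ m)
    by (intros c x; split; intros n; simpl; ring).
  rewrite (surjective_pairing (a m)), (surjective_pairing (b m)); f_equal.
  - apply (pseries_coef_unique (fun m => fst (a m)) (fun m => fst (b m)) (fun x => fst (F x)) d Hd);
      intros x Hx; (eapply is_series_ext; [intros n; apply (proj1 (E _ x))|]);
      apply is_series_Re_Im; auto.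
  - apply (pseries_coef_unique (fun m => snd (a m)) (fun m => snd (b m)) (fun x => snd (F x)) d Hd);
      intros x Hx; (eapply is_series_ext; [intros n; apply (proj2 (E _ x))|]);
      apply is_series_Re_Im; auto.
Qed.

(** * Complex powers and the approximating functions *)

Lemma Cexp_plus (z w : C) : Cexp (z + w) = (Cexp z * Cexp w)%C.
Proof.
  destruct z as [a b], w as [a' b']; unfold Cexp, Re, Im, Cmult; simpl.
  rewrite exp_plus, cos_plus, sin_plus; f_equal; ring.
Qed.

Lemma Cmod_Cexp (z : C) : Cmod (Cexp z) = exp (fst z).
Proof.
  unfold Cmod, Cexp, Re, Im; simpl.
  replace (exp (fst z) * cos (snd z) * (exp (fst z) * cos (snd z) * 1) +
    exp (fst z) * sin (snd z) * (exp (fst z) * sin (snd z) * 1)) with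
    (Rsqr (exp (fst z)) * (Rsqr (sin (snd z)) + Rsqr (cos (snd z)))) by (unfold Rsqr; ring).
  rewrite sin2_cos2, Rmult_1_r, sqrt_Rsqr; [reflexivity|apply Rlt_le, exp_pos].
Qed.

Lemma Rabs_sin_le (b : R) : Rabs (sin b) <= Rabs b.
Proof.
  pose proof (bounded_variation sin cos 1 0 b) as H.
  rewrite sin_0, !Rminus_0_r, Rmult_1_l in H; apply H; intros t _; split.
  - apply is_derive_sin.
  - apply Rabs_le; pose proof (COS_bound t); lra.
Qed.

(** From [cos b - 1 = - 2 sin^2 (b/2)]. *)
Lemma Rabs_cos_minus1_le (b : R) : Rabs (cos b - 1) <= Rabs b ^ 2 / 2.
Proof.
  replace (cos b) with (cos (2 * (b / 2))) by (f_equal; field).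
  rewrite cos_2a_sin.
  pose proof (Rabs_sin_le (b / 2)) as H.
  replace (1 - 2 * sin (b / 2) * sin (b / 2) - 1) with (- (2 * (sin (b / 2)) ^ 2)) by ring.
  rewrite Rabs_Ropp, Rabs_mult, <- RPow_abs, (Rabs_pos_eq 2) by lra.
  unfold Rdiv in H; rewrite Rabs_mult, (Rabs_pos_eq (/ 2)) in H by lra.
  pose proof (Rabs_pos (sin (b * / 2))); pose proof (Rabs_pos b).
  unfold Rdiv; nra.
Qed.

Lemma Rabs_sin_minus_le (b : R) : Rabs b <= 1 -> Rabs (sin b - b) <= Rabs b ^ 2.
Proof.
  intros Hb.
  pose proof (bounded_variation (fun t => sin t - t) (fun t => cos t - 1) (Rabs b) 0 b) as H.
  cbv beta in H; rewrite sin_0, !Rminus_0_r in H; replace (Rabs b ^ 2) with (Rabs b * Rabs b) by ring.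
  apply H; intros t Ht; rewrite Rminus_0_r in Ht; split.
  - auto_derive; [trivial|ring].
  - pose proof (Rabs_cos_minus1_le t); pose proof (Rabs_pos t); nra.
Qed.

(** For [h = a + ib] the two coordinates are [(e^a - 1 - a) + e^a (cos b - 1)] and
    [e^a (sin b - b) + (e^a - 1) b]. With [e^a <= 2] the four terms are at most 2, 1, 2 and 2 times
    [|h|^2], whence 7. *)
Lemma Cexp_taylor1 (h : C) : Cmod h <= 1 / 2 ->
  Cmod (Cexp h - 1 - h) <= 7 * Cmod h ^ 2.
Proof.
  intros Hh; pose proof (fst_le_Cmod h) as Ha; pose proof (snd_le_Cmod h) as Hb.
  destruct h as [a b]; set (m := Cmod (a, b)) in *; simpl fst in Ha; simpl snd in Hb.
  unfold Cexp, Re, Im; simpl fst; simpl snd.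
  pose proof (Rabs_pos a) as Ha0; pose proof (Rabs_pos b) as Hb0.
  assert (Hab : -(1/2) <= a <= 1/2) by (apply Rabs_le_between; lra).
  assert (He1 : Rabs (exp a - 1 - a) <= 2 * Rabs a ^ 2).
  (* Convexity from both sides: [1 + a <= e^a <= 1 / (1 - a)]. *)
  { pose proof (exp_ineq1_le a); pose proof (exp_ineq1_le (- a)).
    rewrite exp_Ropp in H0; pose proof (exp_pos a).
    assert (exp a * (1 - a) <= 1).
    { apply Rmult_le_compat_l with (r := exp a) in H0; [|lra].
      rewrite Rinv_r in H0; lra. }
    rewrite pow2_abs, Rabs_pos_eq by lra.
    assert (exp a * (1 - a) <= (1 + a + 2 * a ^ 2) * (1 - a)) by nra.
    apply Rmult_le_reg_r with (1 - a); lra. }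
  assert (He : 0 < exp a <= 2).
  { split; [apply exp_pos|].
    pose proof (Rle_abs (exp a - 1 - a)); nra. }
  assert (He2 : Rabs (exp a - 1) <= 2 * Rabs a).
  { replace (exp a - 1) with ((exp a - 1 - a) + a) by ring.
    pose proof (Rabs_triang (exp a - 1 - a) a); nra. }
  pose proof (Rabs_cos_minus1_le b) as Hc; pose proof (Rabs_sin_minus_le b ltac:(lra)) as Hs.
  replace (((exp a * cos b)%R, (exp a * sin b)%R) - 1 - (a, b))%C with
    ((exp a - 1 - a) + exp a * (cos b - 1), exp a * (sin b - b) + (exp a - 1) * b)
    by (unfold RtoC, Cminus, Cplus, Copp; simpl; f_equal; ring).
  eapply Rle_trans; [apply Cmod_pair_le|].
  pose proof (Rabs_triang (exp a - 1 - a) (exp a * (cos b - 1))) as T1.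
  pose proof (Rabs_triang (exp a * (sin b - b)) ((exp a - 1) * b)) as T2.
  rewrite !Rabs_mult, (Rabs_pos_eq (exp a)) in T1, T2 by lra.
  assert (Rabs a ^ 2 <= m ^ 2) by (apply pow_incr; lra).
  assert (Rabs b ^ 2 <= m ^ 2) by (apply pow_incr; lra).
  assert (exp a * Rabs (cos b - 1) <= 2 * (Rabs b ^ 2 / 2))
    by (apply Rmult_le_compat; try lra; apply Rabs_pos).
  assert (exp a * Rabs (sin b - b) <= 2 * Rabs b ^ 2)
    by (apply Rmult_le_compat; try lra; apply Rabs_pos).
  assert (Rabs (exp a - 1) * Rabs b <= 2 * m * m)
    by (apply Rmult_le_compat; try lra; apply Rabs_pos).
  rewrite <- Rabs_mult in H3; simpl in *; lra.
Qed.

Lemma Cdiff_Cexp (z : C) : Cdiff Cexp z.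
Proof.
  exists (Cexp z); intros eps Heps.
  set (E := Cmod (Cexp z)); assert (HE : 0 < E) by (unfold E; rewrite Cmod_Cexp; apply exp_pos).
  exists (Rmin (1 / 2) (eps / (7 * E))); split.
  { apply Rmin_glb_lt; [lra|apply Rdiv_lt_0_compat; lra]. }
  intros w Hw; set (h := (w - z)%C) in *.
  pose proof (Rlt_le_trans _ _ _ Hw (Rmin_l _ _)); pose proof (Rlt_le_trans _ _ _ Hw (Rmin_r _ _)).
  replace w with (z + h)%C by (unfold h; ring); rewrite Cexp_plus.
  replace (Cexp z * Cexp h - Cexp z - Cexp z * h)%C with (Cexp z * (Cexp h - 1 - h))%C by ring.
  rewrite Cmod_mult; fold E.
  pose proof (Cexp_taylor1 h ltac:(lra)); pose proof (Cmod_ge_0 h).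
  apply Rlt_div_r in H0; [|lra].
  assert (E * Cmod (Cexp h - 1 - h) <= E * (7 * Cmod h ^ 2)) by (apply Rmult_le_compat_l; lra).
  simpl in *; nra.
Qed.

(* [x^(-s)] for real [x > 0]. *)
Definition Cpw (x : R) (s : C) : C := Cexp (- (s * RtoC (ln x)))%C.

Lemma Cdiff_Cpw (x : R) (s : C) : Cdiff (Cpw x) s.
Proof.
  apply (Cdiff_comp Cexp (fun s => - (s * RtoC (ln x)))%C); [|apply Cdiff_Cexp].
  apply Cdiff_ext with (fun s => - RtoC (ln x) * s)%C; [intros; ring|].
  apply Cdiff_scal, Cdiff_id.
Qed.

Lemma Cmod_Cpw (x : R) (s : C) : Cmod (Cpw x s) = Rpower x (- fst s).
Proof. unfold Cpw; rewrite Cmod_Cexp; unfold Rpower; simpl; f_equal; ring. Qed.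

Lemma Cpw_R (x t : R) : Cpw x (RtoC t) = RtoC (Rpower x (- t)).
Proof.
  unfold Cpw, Cexp, RtoC, Re, Im, Rpower; simpl.
  replace (- (t * 0 + 0 * ln x)) with 0 by ring; rewrite cos_0, sin_0.
  f_equal; [|ring]; rewrite Rmult_1_r; f_equal; ring.
Qed.

Lemma Cpw_minus1 (x : R) (s : C) : 0 < x -> Cpw x (s - 1) = (RtoC x * Cpw x s)%C.
Proof.
  intros Hx; unfold Cpw.
  replace (- ((s - 1) * RtoC (ln x)))%C with (RtoC (ln x) + - (s * RtoC (ln x)))%C by ring.
  rewrite Cexp_plus; f_equal.
  unfold Cexp, RtoC, Re, Im; simpl; rewrite cos_0, sin_0, exp_ln by exact Hx.
  f_equal; ring.
Qed.

(** * Mean value estimates for complex powers of a real variable *)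

Definition Cderiv_at (g : R -> C) (t : R) (l : C) : Prop :=
  is_derive (fun t => fst (g t)) t (fst l) /\ is_derive (fun t => snd (g t)) t (snd l).

(** A complex path has no single intermediate point, so the mean value theorem is applied to each
    coordinate; this costs the factor 2. *)
Lemma Cmean_value_bound (g dg : R -> C) (a b M : R) : a <= b ->
  (forall t, a <= t <= b -> Cderiv_at g t (dg t) /\ Cmod (dg t) <= M) ->
  Cmod (g b - g a) <= 2 * M * (b - a).
Proof.
  intros Hab H.
  assert (B : forall p dp : R -> R, (forall t, a <= t <= b -> is_derive p t (dp t) /\ Rabs (dp t) <= M) ->
    Rabs (p b - p a) <= M * (b - a)).
  { intros p dp Hp.
    destruct (MVT_gen p a b dp) as [c [Hc Ec]].
    - rewrite Rmin_left, Rmax_right by lra; intros x Hx; apply Hp; lra.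
    - rewrite Rmin_left, Rmax_right by lra; intros x Hx.
      apply continuity_pt_filterlim, (ex_derive_continuous (V := R_NormedModule)).
      eexists; now apply Hp.
    - rewrite Rmin_left, Rmax_right in Hc by lra.
      rewrite Ec, Rabs_mult, (Rabs_pos_eq (b - a)) by lra.
      apply Rmult_le_compat_r; [lra|now apply Hp]. }
  rewrite (surjective_pairing (g b - g a)%C).
  eapply Rle_trans; [apply Cmod_pair_le|].
  pose proof (B (fun t => fst (g t)) (fun t => fst (dg t))) as B1.
  pose proof (B (fun t => snd (g t)) (fun t => snd (dg t))) as B2.
  assert (Rabs (fst (g b) - fst (g a)) <= M * (b - a)).
  { apply B1; intros t Ht; destruct (H t Ht) as [[H1 H2] H3]; split; [exact H1|].
    eapply Rle_trans; [apply fst_le_Cmod|exact H3]. }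
  assert (Rabs (snd (g b) - snd (g a)) <= M * (b - a)).
  { apply B2; intros t Ht; destruct (H t Ht) as [[H1 H2] H3]; split; [exact H2|].
    eapply Rle_trans; [apply snd_le_Cmod|exact H3]. }
  simpl; unfold Rminus in *; lra.
Qed.

Lemma Cpw_deriv (y : R) (s : C) : 0 < y ->
  Cderiv_at (fun y => Cpw y s) y (- s * (RtoC (/ y) * Cpw y s))%C.
Proof.
  intros Hy; destruct s as [a b]; unfold Cpw, Cexp, Re, Im; split; simpl;
    (auto_derive; [lra|]); unfold Rminus; field; lra.
Qed.

Lemma Rpower_neg_anti (x y p : R) : 0 < x -> x <= y -> 0 <= p -> Rpower y (- p) <= Rpower x (- p).
Proof.
  intros Hx Hxy Hp; rewrite !Rpower_Ropp.
  apply Rinv_le_contravar; [apply exp_pos|].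
  now apply Rle_Rpower_l.
Qed.

Lemma Cpw_lipschitz (x h : R) (s : C) : 0 < x -> 0 <= h -> 0 <= fst s ->
  Cmod (Cpw (x + h) s - Cpw x s) <= 2 * Cmod s * Rpower x (- fst s - 1) * h.
Proof.
  intros Hx Hh Hs.
  pose proof (Cmean_value_bound (fun y => Cpw y s) (fun y => - s * (RtoC (/ y) * Cpw y s))%C x (x + h)
    (Cmod s * Rpower x (- fst s - 1))) as H.
  replace (x + h - x) with h in H by ring.
  rewrite <- Rmult_assoc in H; apply H; [lra|]; clear H.
  intros y Hy; split; [apply Cpw_deriv; lra|].
  rewrite !Cmod_mult, Cmod_opp, Cmod_R, Cmod_Cpw.
  assert (0 < / y) by (apply Rinv_0_lt_compat; lra).
  rewrite Rabs_pos_eq by lra.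
  apply Rmult_le_compat_l; [apply Cmod_ge_0|].
  replace (/ y) with (Rpower y (- (1))) by (rewrite Rpower_Ropp, Rpower_1; lra).
  rewrite <- Rpower_plus.
  replace (- (1) + - fst s) with (- (fst s + 1)) by ring.
  replace (- fst s - 1) with (- (fst s + 1)) by ring.
  apply Rpower_neg_anti; lra.
Qed.

(* The left-hand side is [(s - 1) (h x^(-s) - \int_x^(x+h) y^(-s) dy)]. *)
Lemma Cpw_increment (x h : R) (s : C) : 0 < x -> 0 <= h -> 0 <= fst s ->
  Cmod ((s - 1) * RtoC h * Cpw x s + (Cpw (x + h) (s - 1) - Cpw x (s - 1)))
  <= 4 * Cmod (s - 1) * Cmod s * h ^ 2 * Rpower x (- fst s - 1).
Proof.
  intros Hx Hh Hs.
  (* Its derivative is [(s - 1) (x^(-s) - (x+t)^(-s))], which [Cpw_lipschitz] bounds by [M] for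
     [t <= h]; the left-hand side is [g h - g 0]. *)
  set (g := fun t => ((s - 1) * Cpw x s * RtoC t + Cpw (x + t) (s - 1))%C).
  set (M := Cmod (s - 1) * (2 * Cmod s * Rpower x (- fst s - 1) * h)).
  assert (HR : 0 < Rpower x (- fst s - 1)) by apply exp_pos.
  pose proof (Cmod_ge_0 s) as Hs0; pose proof (Cmod_ge_0 (s - 1)) as Hs1.
  pose proof (Cmean_value_bound g (fun t => (s - 1) * (Cpw x s - Cpw (x + t) s))%C 0 h M Hh) as H.
  replace ((s - 1) * RtoC h * Cpw x s + (Cpw (x + h) (s - 1) - Cpw x (s - 1)))%C
    with (g h - g 0)%C by (unfold g; rewrite Rplus_0_r; ring).
  replace (4 * Cmod (s - 1) * Cmod s * h ^ 2 * Rpower x (- fst s - 1))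
    with (2 * M * (h - 0)) by (unfold M; ring).
  apply H; intros t Ht; split.
  - destruct (Cpw_deriv (x + t) (s - 1)) as [D1 D2]; [lra|].
    replace ((s - 1) * (Cpw x s - Cpw (x + t) s))%C with
      ((s - 1) * Cpw x s + - (s - 1) * (RtoC (/ (x + t)) * Cpw (x + t) (s - 1)))%C.
    2:{ rewrite (Cpw_minus1 (x + t)) by lra.
        rewrite RtoC_inv by lra; field.
        intros E; apply RtoC_inj in E; lra. }
    unfold g; clear g H; set (A := ((s - 1) * Cpw x s)%C) in *.
    assert (Sh : forall (p : R -> R) l, is_derive p (x + t) l -> is_derive (fun t => p (x + t)) t l).
    { intros p l Hp; replace l with (scal 1 l) by (unfold scal; simpl; unfold mult; simpl; ring).
      apply (is_derive_comp p (fun t => x + t)); [exact Hp|].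
      auto_derive; [trivial|ring]. }
    apply (Sh (fun y => fst (Cpw y (s - 1)))) in D1.
    apply (Sh (fun y => snd (Cpw y (s - 1)))) in D2.
    clearbody A; split.
    + apply (is_derive_ext (fun t => fst A * t + fst (Cpw (x + t) (s - 1)))).
      { intros u; simpl; ring. }
      apply (is_derive_plus (V := R_NormedModule) (fun t => fst A * t)); [|exact D1].
      auto_derive; [trivial|ring].
    + apply (is_derive_ext (fun t => snd A * t + snd (Cpw (x + t) (s - 1)))).
      { intros u; simpl; ring. }
      apply (is_derive_plus (V := R_NormedModule) (fun t => snd A * t)); [|exact D2].
      auto_derive; [trivial|ring].
  - rewrite Cmod_mult; unfold M; apply Rmult_le_compat_l; [exact Hs1|].
    rewrite Cmod_minus_sym; eapply Rle_trans; [apply Cpw_lipschitz; lra|].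
    apply Rmult_le_compat_l; [|lra].
    apply Rmult_le_pos; lra.
Qed.

(** * The approximating functions along the progression *)

Definition prog (r q k : nat) : R := INR (r + k * q).

Lemma prog_S (r q k : nat) : prog r q (S k) = prog r q k + INR q.
Proof. unfold prog; rewrite <- plus_INR; f_equal; simpl; lia. Qed.

Lemma prog_ge1 (r q k : nat) : (1 <= r)%nat -> 1 <= prog r q k.
Proof. intros H; apply (le_INR 1); lia. Qed.

(** Half-open, over [k < n], unlike the inclusive [sum_n]: the empty sum is available. The general
    monoid serves both real and complex sums. *)
Fixpoint psum {G : AbelianMonoid} (u : nat -> G) (n : nat) : G :=
  match n with O => zero | S n => plus (psum u n) (u n) end.

(* [(s - 1)] times the [K]-th Euler-Maclaurin approximation
   [\sum_(k<K) x_k^(-s) - x_K^(1-s) / (q (1-s))] of the partial zeta function;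
   the factor makes it entire. *)
Definition zapp (r q K : nat) (s : C) : C :=
  ((s - 1) * psum (G := C_AbelianMonoid) (fun k => Cpw (prog r q k) s) K
   + RtoC (/ INR q) * Cpw (prog r q K) (s - 1))%C.

Lemma Cdiff_psum (u : nat -> C -> C) (K : nat) (z : C) :
  (forall k, Cdiff (u k) z) ->
  Cdiff (fun s => psum (G := C_AbelianMonoid) (fun k => u k s) K) z.
Proof.
  intros H; induction K as [|K IH]; simpl.
  - apply Cdiff_const.
  - apply (Cdiff_plus _ (u K)); [exact IH|apply H].
Qed.

Lemma Cdiff_zapp (r q K : nat) (z : C) : Cdiff (zapp r q K) z.
Proof.
  assert (H1 : Cdiff (fun s => s - 1)%C z) by (apply Cdiff_minus; [apply Cdiff_id|apply Cdiff_const]).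
  apply Cdiff_plus.
  - apply Cdiff_mult; [exact H1|].
    apply Cdiff_psum; intros k; apply Cdiff_Cpw.
  - apply Cdiff_scal, (Cdiff_comp (Cpw (prog r q K)) (fun s => s - 1)%C); [exact H1|apply Cdiff_Cpw].
Qed.

(** Brings one step of the approximation into the form bounded by [Cpw_increment], with [h = q]. *)
Lemma zapp_S (r q K : nat) (s : C) : (1 <= q)%nat ->
  (zapp r q (S K) s - zapp r q K s)%C =
  (RtoC (/ INR q) * ((s - 1) * RtoC (INR q) * Cpw (prog r q K) s +
     (Cpw (prog r q K + INR q) (s - 1) - Cpw (prog r q K) (s - 1))))%C.
Proof.
  intros Hq; unfold zapp; rewrite prog_S; simpl psum.
  change (@plus C_AbelianMonoid) with Cplus.
  assert (INR q <> 0) by (apply not_0_INR; lia).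
  rewrite RtoC_inv by assumption; field.
  intros E; apply RtoC_inj in E; lra.
Qed.

(** Prepares telescoping. The difference on the right equals [h b c^(-b-1)] with [c] between [x] and
    [x + h], and [x + h <= x (1 + h)] as [x >= 1]; this is the origin of [(1 + h)^(b+1)]. *)
Lemma Rpower_diff_lower (x h b : R) : 1 <= x -> 0 < h -> 0 < b ->
  Rpower x (- b - 1) <= Rpower (1 + h) (b + 1) / (h * b) * (Rpower x (- b) - Rpower (x + h) (- b)).
Proof.
  intros Hx Hh Hb.
  destruct (MVT_gen (fun y => Rpower y (- b)) x (x + h) (fun y => - b * Rpower y (- b - 1)))
    as [c [Hc Ec]].
  - rewrite Rmin_left, Rmax_right by lra; intros y Hy.
    unfold Rpower; auto_derive; [lra|].
    replace ((- b - 1) * ln y) with (- b * ln y + - ln y) by ring.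
    rewrite exp_plus, exp_Ropp, exp_ln by lra; field; lra.
  - rewrite Rmin_left, Rmax_right by lra; intros y Hy.
    apply continuity_pt_filterlim, (ex_derive_continuous (V := R_NormedModule) (fun y => Rpower y (- b))).
    unfold Rpower; auto_derive; lra.
  - rewrite Rmin_left, Rmax_right in Hc by lra.
    replace (Rpower x (- b) - Rpower (x + h) (- b)) with (h * b * Rpower c (- b - 1))
      by (replace (x + h - x) with h in Ec by ring; lra).
    replace (Rpower (1 + h) (b + 1) / (h * b) * (h * b * Rpower c (- b - 1)))
      with (Rpower (1 + h) (b + 1) * Rpower c (- b - 1)) by (field; lra).
    assert (Hcx : Rpower (x * (1 + h)) (- (b + 1)) <= Rpower c (- (b + 1)))
      by (apply Rpower_neg_anti; nra).
    replace (- b - 1) with (- (b + 1)) by ring.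
    rewrite <- Rpower_mult_distr in Hcx by lra.
    rewrite (Rpower_Ropp (1 + h)) in Hcx.
    assert (HP : 0 < Rpower (1 + h) (b + 1)) by apply exp_pos.
    apply Rmult_le_compat_l with (r := Rpower (1 + h) (b + 1)) in Hcx; [|lra].
    eapply Rle_trans; [|exact Hcx]; right; field; lra.
Qed.

(** Each step is at most [A] times a difference of consecutive values of [x_k^(-b)], so the sum from
    [K] to [L] telescopes. [A] depends on [s] only through the bounds [b] and [B], which is the
    uniformity needed. *)
Lemma zapp_cauchy (r q : nat) (b B : R) : (1 <= r)%nat -> (1 <= q)%nat -> 0 < b ->
  exists A, 0 <= A /\ forall s, b <= fst s -> Cmod s <= B ->
    forall K L, (K <= L)%nat ->
      Cmod (zapp r q L s - zapp r q K s) <= A * Rpower (prog r q K) (- b).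
Proof.
  intros Hr Hq Hb.
  assert (Hq0 : 0 < INR q) by (apply lt_0_INR; lia).
  set (D := Rpower (1 + INR q) (b + 1) / (INR q * b)).
  assert (HD : 0 < D).
  { apply Rdiv_lt_0_compat; [apply exp_pos|apply Rmult_lt_0_compat; lra]. }
  (* [|B|] instead of [B] keeps [A >= 0] for negative [B] too, where no [s] qualifies. *)
  pose proof (Rabs_pos B) as HB; set (A := 4 * (Rabs B + 1) * Rabs B * INR q * D).
  assert (HA : 0 <= A) by (unfold A; clearbody D; repeat apply Rmult_le_pos; lra).
  exists A; split; [exact HA|]; intros s Hs HsB K L HKL.
  assert (HsB' : Cmod s <= Rabs B) by (pose proof (Rle_abs B); lra).
  set (T := fun k => Rpower (prog r q k) (- b)).
  assert (Hstep : forall k, Cmod (zapp r q (S k) s - zapp r q k s) <= A * (T k - T (S k))).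
  { intros k; rewrite zapp_S by exact Hq.
    pose proof (prog_ge1 r q k Hr) as Hx.
    rewrite Cmod_mult, Cmod_R, Rabs_pos_eq by (apply Rlt_le, Rinv_0_lt_compat; lra).
    pose proof (Cpw_increment (prog r q k) (INR q) s ltac:(lra) ltac:(lra) ltac:(lra)) as Hi.
    pose proof (Rpower_diff_lower (prog r q k) (INR q) b Hx Hq0 Hb) as Hd.
    fold D in Hd; rewrite <- prog_S in Hd; fold (T k) in Hd; fold (T (S k)) in Hd.
    assert (Hx1 : Rpower (prog r q k) (- fst s - 1) <= Rpower (prog r q k) (- b - 1))
      by (apply Rle_Rpower; lra).
    assert (Hs1 : Cmod (s - 1) <= Rabs B + 1).
    { pose proof (Cmod_triangle s (- (1))) as H1; rewrite Cmod_opp, Cmod_1 in H1.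
      unfold Cminus; lra. }
    assert (0 < Rpower (prog r q k) (- fst s - 1)) by apply exp_pos.
    pose proof (Cmod_ge_0 s); pose proof (Cmod_ge_0 (s - 1)).
    apply Rle_trans with (/ INR q *
      (4 * Cmod (s - 1) * Cmod s * INR q ^ 2 * Rpower (prog r q k) (- fst s - 1))).
    { apply Rmult_le_compat_l; [apply Rlt_le, Rinv_0_lt_compat; lra|exact Hi]. }
    replace (/ INR q * (4 * Cmod (s - 1) * Cmod s * INR q ^ 2 * Rpower (prog r q k) (- fst s - 1)))
      with (4 * Cmod (s - 1) * Cmod s * INR q * Rpower (prog r q k) (- fst s - 1)) by (field; lra).
    replace (A * (T k - T (S k))) with
      (4 * (Rabs B + 1) * Rabs B * INR q * (D * (T k - T (S k)))) by (unfold A; ring).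
    assert (4 * Cmod (s - 1) * Cmod s <= 4 * (Rabs B + 1) * Rabs B)
      by (apply Rmult_le_compat; try lra; apply Rmult_le_pos; lra).
    apply Rmult_le_compat; try lra.
    - repeat apply Rmult_le_pos; lra.
    - apply Rmult_le_compat_r; lra. }
  assert (HT : Cmod (zapp r q L s - zapp r q K s) <= A * (T K - T L)).
  { induction HKL as [|L HKL IH].
    - replace (zapp r q K s - zapp r q K s)%C with (RtoC 0) by ring; rewrite Cmod_0; lra.
    - eapply Rle_trans; [apply (Cmod_minus_triangle _ (zapp r q L s))|].
      specialize (Hstep L); lra. }
  assert (0 < T L) by apply exp_pos.
  fold (T K); nra.
Qed.

Lemma prog_power_lim (r q : nat) (b : R) : (1 <= r)%nat -> (1 <= q)%nat -> 0 < b ->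
  forall eps, 0 < eps -> exists N, forall K, (N <= K)%nat -> Rpower (prog r q K) (- b) < eps.
Proof.
  intros Hr Hq Hb eps Heps.
  (* The threshold solves [x^(-b) = eps], and [x_K >= K]. *)
  destruct (nfloor_ex (Rpower eps (- / b))) as [N HN]; [apply Rlt_le, exp_pos|].
  exists (S N); intros K HK.
  assert (Hx : Rpower eps (- / b) < prog r q K).
  { apply Rlt_le_trans with (INR N + 1); [apply HN|].
    rewrite <- S_INR; apply le_INR; nia. }
  assert (Hp : 0 < Rpower eps (- / b)) by apply exp_pos.
  replace eps with (Rpower (Rpower eps (- / b)) (- b)) at 1.
  - set (y := Rpower eps (- / b)) in *; clearbody y.
    rewrite !Rpower_Ropp; apply Rinv_lt_contravar.
    + apply Rmult_lt_0_compat; apply exp_pos.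
    + apply Rlt_Rpower_l; lra.
  - rewrite Rpower_mult; replace (- / b * - b) with 1 by (field; lra); now apply Rpower_1.
Qed.

(** * Convergence of Taylor coefficients *)

Definition Ccv (u : nat -> C) (l : C) : Prop :=
  forall eps, 0 < eps -> exists N, forall n, (N <= n)%nat -> Cmod (u n - l) < eps.

Lemma Ccv_unique (u : nat -> C) (l l' : C) : Ccv u l -> Ccv u l' -> l = l'.
Proof.
  intros H H'; apply Ceq_minus, Cmod_eq_0, Rle_antisym; [|apply Cmod_ge_0].
  apply le_epsilon; intros eps Heps.
  destruct (H (eps / 2)) as [N HN]; [lra|]; destruct (H' (eps / 2)) as [N' HN']; [lra|].
  specialize (HN (N + N')%nat ltac:(lia)); specialize (HN' (N + N')%nat ltac:(lia)).
  pose proof (Cmod_minus_triangle l (u (N + N')%nat) l').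
  rewrite (Cmod_minus_sym l (u _)) in H0; lra.
Qed.

Lemma Ccv_le (u : nat -> C) (l z : C) (M : R) (K : nat) : Ccv u l ->
  (forall n, (K <= n)%nat -> Cmod (u n - z) <= M) -> Cmod (l - z) <= M.
Proof.
  intros H HM; apply le_epsilon; intros eps Heps.
  destruct (H eps Heps) as [N HN].
  specialize (HN (N + K)%nat ltac:(lia)); specialize (HM (N + K)%nat ltac:(lia)).
  pose proof (Cmod_minus_triangle l (u (N + K)%nat) z).
  rewrite (Cmod_minus_sym l (u _)) in H0; lra.
Qed.

Lemma Ccv_squeeze (u : nat -> C) (l : C) (T : nat -> R) :
  (forall n, Cmod (u n - l) <= T n) ->
  (forall eps, 0 < eps -> exists N, forall n, (N <= n)%nat -> T n < eps) -> Ccv u l.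
Proof.
  intros H HT eps Heps; destruct (HT eps Heps) as [N HN]; exists N; intros n Hn.
  eapply Rle_lt_trans; [apply H|now apply HN].
Qed.

Lemma Ccv_sum (u : nat -> nat -> C) (v : nat -> C) (N : nat) :
  (forall m, Ccv (fun n => u n m) (v m)) ->
  Ccv (fun n => sum_n (G := C_AbelianMonoid) (u n) N) (sum_n (G := C_AbelianMonoid) v N).
Proof.
  intros H; induction N as [|N IH].
  - intros eps Heps; destruct (H 0%nat eps Heps) as [M HM]; exists M; intros n Hn.
    rewrite !sum_O; now apply HM.
  - intros eps Heps.
    destruct (IH (eps / 2)) as [M1 HM1]; [lra|]; destruct (H (S N) (eps / 2)) as [M2 HM2]; [lra|].
    exists (M1 + M2)%nat; intros n Hn; rewrite !sum_Sn.
    change (@plus C_AbelianMonoid) with Cplus.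
    specialize (HM1 n ltac:(lia)); specialize (HM2 n ltac:(lia)).
    set (x := sum_n (u n) N) in *; set (y := sum_n v N) in *.
    replace (x + u n (S N) - (y + v (S N)))%C with ((x - y) + (u n (S N) - v (S N)))%C by ring.
    eapply Rle_lt_trans; [apply Cmod_triangle|lra].
Qed.

Lemma geom_tail (u : nat -> C) (U : C) (B theta : R) : 0 <= theta < 1 ->
  (forall m, Cmod (u m) <= B * theta ^ m) ->
  is_series (K := C_AbsRing) (V := C_NormedModule) u U ->
  forall N, Cmod (U - sum_n (G := C_AbelianMonoid) u N) <= B / (1 - theta) * theta ^ S N.
Proof.
  intros Ht Hu HU N.
  assert (HB : 0 <= B) by (specialize (Hu 0%nat); pose proof (Cmod_ge_0 (u 0%nat)); simpl in Hu; lra).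
  assert (H : forall k, Cmod (sum_n (G := C_AbelianMonoid) u (N + k) - sum_n (G := C_AbelianMonoid) u N)
    <= B / (1 - theta) * (theta ^ S N - theta ^ S (N + k))).
  { induction k as [|k IH].
    - rewrite Nat.add_0_r.
      replace (sum_n (G := C_AbelianMonoid) u N - sum_n (G := C_AbelianMonoid) u N)%C
        with (RtoC 0) by ring.
      rewrite Cmod_0; right; ring.
    - rewrite Nat.add_succ_r, sum_Sn.
      change (@plus C_AbelianMonoid) with Cplus.
      set (x := sum_n u (N + k)) in *; set (y := sum_n u N) in *.
      replace (x + u (S (N + k)) - y)%C with ((x - y) + u (S (N + k)))%C by ring.
      eapply Rle_trans; [apply Cmod_triangle|].
      specialize (Hu (S (N + k))).
      replace (B / (1 - theta) * (theta ^ S N - theta ^ S (S (N + k)))) with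
        (B / (1 - theta) * (theta ^ S N - theta ^ S (N + k)) + B * theta ^ S (N + k))
        by (simpl; field; lra).
      lra. }
  assert (Hc : 0 <= B / (1 - theta)) by (apply Rdiv_le_0_compat; lra).
  apply (Ccv_le (sum_n (G := C_AbelianMonoid) u) U _ _ N).
  - exact (proj1 (is_series_C_eps u U) HU).
  - intros n Hn; replace n with (N + (n - N))%nat by lia.
    eapply Rle_trans; [apply H|].
    assert (0 <= theta ^ S (N + (n - N))) by (apply pow_le; lra).
    apply Rmult_le_compat_l; lra.
Qed.

(** Dominated convergence for series: the common geometric majorant, inherited by [v], makes all
    tails small at once, and the finitely many remaining terms converge one by one. *)
Lemma Tannery (u : nat -> nat -> C) (v : nat -> C) (U : nat -> C) (V : C) (B theta : R) :
  0 <= theta < 1 ->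
  (forall n m, Cmod (u n m) <= B * theta ^ m) ->
  (forall m, Ccv (fun n => u n m) (v m)) ->
  (forall n, is_series (K := C_AbsRing) (V := C_NormedModule) (u n) (U n)) ->
  is_series (K := C_AbsRing) (V := C_NormedModule) v V ->
  Ccv U V.
Proof.
  intros Ht Hu Hv HU HV.
  assert (Hvb : forall m, Cmod (v m) <= B * theta ^ m).
  { intros m; replace (v m) with (v m - 0)%C by ring.
    apply (Ccv_le _ _ _ _ 0%nat (Hv m)); intros n _.
    replace (u n m - 0)%C with (u n m) by ring; apply Hu. }
  intros eps Heps.
  destruct (geom_small (B / (1 - theta)) theta (eps / 3) Ht) as [N HN]; [lra|].
  specialize (HN (S N) ltac:(lia)).
  destruct (Ccv_sum u v N Hv (eps / 3)) as [M HM]; [lra|].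
  exists M; intros n Hn; specialize (HM n Hn).
  pose proof (geom_tail (u n) (U n) B theta Ht (Hu n) (HU n) N) as T1.
  pose proof (geom_tail v V B theta Ht Hvb HV N) as T2.
  set (x := sum_n (u n) N) in *; set (y := sum_n v N) in *.
  replace (U n - V)%C with ((U n - x) + (x - y) + - (V - y))%C by ring.
  eapply Rle_lt_trans; [apply Cmod_triangle|]; rewrite Cmod_opp.
  pose proof (Cmod_triangle (U n - x) (x - y)); lra.
Qed.

Lemma is_series_C_minus (a b : nat -> C) (x y : C) :
  is_series (K := C_AbsRing) (V := C_NormedModule) a x ->
  is_series (K := C_AbsRing) (V := C_NormedModule) b y ->
  is_series (K := C_AbsRing) (V := C_NormedModule) (fun m => a m - b m)%C (x - y)%C.
Proof. apply (is_series_minus (K := C_AbsRing) (V := C_NormedModule)). Qed.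

Lemma is_series_C_ext (a b : nat -> C) (x : C) : (forall m, a m = b m) ->
  is_series (K := C_AbsRing) (V := C_NormedModule) a x ->
  is_series (K := C_AbsRing) (V := C_NormedModule) b x.
Proof. apply (is_series_ext (K := C_AbsRing) (V := C_NormedModule)). Qed.

Lemma has_taylor_minus (f g : C -> C) (z0 : C) (rho : R) (c d : nat -> C) :
  has_taylor f z0 rho c -> has_taylor g z0 rho d ->
  has_taylor (fun w => f w - g w)%C z0 rho (fun m => c m - d m)%C.
Proof.
  intros Hf Hg s Hs.
  eapply is_series_C_ext; [|exact (is_series_C_minus _ _ _ _ (Hf s Hs) (Hg s Hs))].
  intros m; simpl; ring.
Qed.

Lemma has_taylor_real (f : C -> C) (z0 : C) (rho : R) (c : nat -> C) : has_taylor f z0 rho c ->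
  forall x, Rabs x < rho -> is_series (K := C_AbsRing) (V := C_NormedModule)
    (fun m => c m * RtoC (x ^ m))%C (f (z0 + RtoC x)%C).
Proof.
  intros H x Hx.
  assert (E : (z0 + RtoC x - z0)%C = RtoC x) by ring.
  eapply is_series_C_ext; [|apply H; rewrite E, Cmod_R; exact Hx].
  intros m; simpl; rewrite E, Cpow_R; reflexivity.
Qed.

(** The radii may differ, so an expansion on a large disc can be compared with one on a small
    square, where better bounds hold. *)
Lemma has_taylor_unique (f : C -> C) (z0 : C) (rho rho' : R) (c c' : nat -> C) :
  0 < rho -> 0 < rho' -> has_taylor f z0 rho c -> has_taylor f z0 rho' c' ->
  forall m, c m = c' m.
Proof.
  intros Hr Hr' H H'.
  apply (Cseries_coef_unique c c' (fun x => f (z0 + RtoC x)%C) (Rmin rho rho')).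
  - now apply Rmin_glb_lt.
  - intros x Hx; apply (has_taylor_real f z0 rho c H), (Rlt_le_trans _ _ _ Hx), Rmin_l.
  - intros x Hx; apply (has_taylor_real f z0 rho' c' H'), (Rlt_le_trans _ _ _ Hx), Rmin_r.
Qed.

Lemma square_fst_snd (z0 : C) (rho : R) (P : C -> Prop) :
  (forall z, Rabs (fst z - fst z0) <= rho -> Rabs (snd z - snd z0) <= rho -> P z) -> square z0 rho P.
Proof. intros H x y Hx Hy; apply H; simpl; apply Rabs_le; lra. Qed.

(* Vitali's theorem in the form needed here: the Taylor coefficients at a far away real
   centre converge because the functions do there, and are uniformly dominated on a disc
   reaching up to the boundary of the half-plane. *)
Theorem half_plane_continuation (E : nat -> C -> C) (Y : C -> C) :
  (forall K z, Cdiff (E K) z) -> (forall z, Cdiff Y z) ->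
  (forall b B, 0 < b -> exists T : nat -> R,
     (forall eps, 0 < eps -> exists N, forall K, (N <= K)%nat -> T K < eps) /\
     forall z, b <= fst z -> Cmod z <= B -> forall K L, (K <= L)%nat ->
       Cmod (E L z - E K z) <= T K) ->
  (forall z, 1 < fst z -> Ccv (fun K => E K z) (Y z)) ->
  forall z, 0 < fst z -> Ccv (fun K => E K z) (Y z).
Proof.
  intros HE HY Hunif Hconv s Hs.
  destruct s as [x y]; simpl in Hs; set (s := (x, y)).
  (* [|s - c| < c] means [2 x c > x^2 + y^2], which holds for large [c]. The added 2 puts the square
     of half-side [1 / 2] about [c0] inside [Re z > 1]. *)
  set (c0 := (x * x + y * y) / x + 2).
  assert (Hc0 : 2 <= c0).
  { unfold c0; assert (0 <= (x * x + y * y) / x) by (apply Rdiv_le_0_compat; nra); lra. }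
  assert (Hdist : Cmod (s - RtoC c0) < c0).
  { apply Rsqr_incrst_0; [|apply Cmod_ge_0|lra].
    unfold Rsqr; replace (Cmod (s - RtoC c0) * Cmod (s - RtoC c0)) with (Cmod (s - RtoC c0) ^ 2) by ring.
    rewrite Cmod2_alt; unfold Re, Im, s; simpl.
    assert (x * c0 = x * x + y * y + 2 * x) by (unfold c0; field; lra).
    nra. }
  set (d := Cmod (s - RtoC c0)) in *; assert (Hd : 0 <= d) by apply Cmod_ge_0.
  (* Large enough for the disc to contain [s], small enough for the square to stay in
     [Re z >= c0 - rho > 0]. *)
  set (rho := (d + c0) / 2).
  assert (Hrho : d < rho < c0) by (unfold rho; lra).
  assert (Hsq : forall rho' z, Rabs (fst z - fst (RtoC c0)) <= rho' -> Rabs (snd z - snd (RtoC c0)) <= rho' ->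
    c0 - rho' <= fst z /\ Cmod z <= c0 + rho' + rho').
  { intros rho' z H1 H2; simpl in H1, H2; rewrite Rminus_0_r in H2.
    apply Rabs_le_between in H1; split; [lra|].
    rewrite (surjective_pairing z); eapply Rle_trans; [apply Cmod_pair_le|].
    assert (Rabs (fst z) <= c0 + rho') by (apply Rabs_le; lra); lra. }
  destruct (Hunif (c0 - rho) (c0 + rho + rho)) as [T [_ HT]]; [lra|].
  destruct (Hunif (c0 - 1 / 2) (c0 + 1 / 2 + 1 / 2)) as [T' [HT'0 HT']]; [lra|].
  (* The Cauchy estimate bounds only differences; subtracting [E 0] makes the functions bounded by
     [T 0], uniformly in [K], and so gives the geometric majorant for [Tannery]. *)
  destruct (ClassicalEpsilon.choice (fun K c => has_taylor (fun w => E K w - E 0%nat w)%C (RtoC c0) rho c /\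
    forall m, Cmod (c m) <= 2 * T 0%nat / rho ^ m)) as [u Hu].
  { intros K; destruct (Taylor_square (fun w => E K w - E 0%nat w)%C (RtoC c0) rho) as [c [Hc1 Hc2]]; [lra| |].
    - intros a b _ _; now apply Cdiff_minus.
    - exists c; split; [exact Hc1|]; apply Hc2, square_fst_snd; intros z H1 H2.
      destruct (Hsq _ _ H1 H2); apply HT; [assumption|assumption|lia]. }
  destruct (Taylor_square (fun w => Y w - E 0%nat w)%C (RtoC c0) rho) as [v [Hv _]]; [lra| |].
  { intros a b _ _; now apply Cdiff_minus. }
  (* By uniqueness the coefficients at [c0] may be estimated on the small square, where convergence
     to [Y] is given and the Cauchy bound [T' K] passes to the limit. *)
  assert (Hcoef : forall K m, Cmod (u K m - v m) <= 2 * T' K / (1 / 2) ^ m).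
  { intros K m.
    destruct (Taylor_square (fun w => E K w - Y w)%C (RtoC c0) (1 / 2)) as [w [Hw1 Hw2]]; [lra| |].
    { intros a b _ _; now apply Cdiff_minus. }
    replace (u K m - v m)%C with (w m).
    - apply Hw2, square_fst_snd; intros z H1 H2.
      destruct (Hsq _ _ H1 H2); rewrite Cmod_minus_sym.
      apply (Ccv_le (fun K => E K z) _ _ _ K); [apply Hconv; lra|].
      intros n Hn; now apply HT'.
    - symmetry; apply (has_taylor_unique (fun w => E K w - Y w)%C (RtoC c0) rho (1 / 2)
        (fun m => u K m - v m)%C w); try lra; [|exact Hw1].
      intros z Hz; pose proof (has_taylor_minus _ _ _ _ _ _ (proj1 (Hu K)) Hv z Hz) as HH.
      cbv beta in HH.
      replace (E K z - Y z)%C with (E K z - E 0%nat z - (Y z - E 0%nat z))%C by ring; exact HH. }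
  assert (HV : Ccv (fun K => E K s - E 0%nat s)%C (Y s - E 0%nat s)%C).
  { apply (Tannery (fun K m => u K m * Cpow (s - RtoC c0) m)%C (fun m => v m * Cpow (s - RtoC c0) m)%C
      (fun K => E K s - E 0%nat s)%C (Y s - E 0%nat s)%C (2 * T 0%nat) (d / rho)).
    - split; [apply Rdiv_le_0_compat; lra|apply Rlt_div_l; lra].
    - intros n m; rewrite Cmod_mult, Cmod_pow; fold d.
      assert (0 < rho ^ m) by (apply pow_lt; lra).
      replace (2 * T 0%nat * (d / rho) ^ m) with (2 * T 0%nat / rho ^ m * d ^ m)
        by (unfold Rdiv; rewrite Rpow_mult_distr, pow_inv; field; lra).
      apply Rmult_le_compat_r; [apply pow_le; lra|apply Hu].
    - intros m.
      apply (Ccv_squeeze _ _ (fun K => 2 * T' K / (1 / 2) ^ m * d ^ m)).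
      + intros K; replace (u K m * Cpow (s - RtoC c0) m - v m * Cpow (s - RtoC c0) m)%C
          with ((u K m - v m) * Cpow (s - RtoC c0) m)%C by ring.
        rewrite Cmod_mult, Cmod_pow; fold d.
        apply Rmult_le_compat_r; [apply pow_le; lra|apply Hcoef].
      + intros eps Heps.
        assert (Hp : 0 < (1 / 2) ^ m) by (apply pow_lt; lra).
        assert (Hdm : 0 <= d ^ m) by (apply pow_le; lra).
        set (k := 2 / (1 / 2) ^ m * d ^ m).
        assert (Hk : 0 <= k) by (apply Rmult_le_pos; [apply Rdiv_le_0_compat; lra|lra]).
        destruct (HT'0 (eps / (k + 1))) as [N HN]; [apply Rdiv_lt_0_compat; lra|].
        exists N; intros K HK; specialize (HN K HK).
        apply Rlt_div_r in HN; [|lra].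
        replace (2 * T' K / (1 / 2) ^ m * d ^ m) with (T' K * k) by (unfold k; field; lra).
        (* The sign of [T' K] is not given. *)
        destruct (Rle_dec 0 (T' K)); nra.
    - intros K; apply Hu; exact (proj1 Hrho).
    - apply Hv; exact (proj1 Hrho). }
  intros eps Heps; destruct (HV eps Heps) as [N HN]; exists N; intros n Hn.
  specialize (HN n Hn).
  now replace (E n s - Y s)%C with (E n s - E 0%nat s - (Y s - E 0%nat s))%C by ring.
Qed.

(** * The partial zeta function as a limit *)

Lemma psum_ext {G : AbelianMonoid} (u v : nat -> G) (n : nat) :
  (forall k, u k = v k) -> psum u n = psum v n.
Proof. intros H; induction n as [|n IH]; simpl; [reflexivity|now rewrite IH, H]. Qed.

Lemma sum_n_psum {G : AbelianMonoid} (a : nat -> G) (n : nat) : sum_n a n = psum a (S n).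
Proof.
  induction n as [|n IH].
  - rewrite sum_O; simpl; now rewrite plus_zero_l.
  - rewrite sum_Sn, IH; reflexivity.
Qed.

Lemma sum_n_m_psum {G : AbelianMonoid} (a : nat -> G) (n : nat) :
  sum_n_m a 1 n = psum (fun k => a (S k)) n.
Proof.
  induction n as [|n IH]; simpl.
  - apply sum_n_m_zero; lia.
  - rewrite sum_n_Sm by lia; now rewrite IH.
Qed.

Lemma congr_mod_prog (r q k : nat) : congr_mod q (r + k * q) r = true.
Proof. unfold congr_mod; rewrite Nat.Div0.mod_add; apply Nat.eqb_refl. Qed.

(** Congruent numbers differ by a multiple of [q], and none lies strictly between 0 and [q]. *)
Lemma congr_mod_between (r q n k : nat) : (1 <= q)%nat ->
  (n < r + k * q)%nat -> (r + k * q < n + q)%nat -> congr_mod q n r = false.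
Proof.
  intros Hq H1 H2; apply Nat.eqb_neq; intros E.
  rewrite <- (Nat.Div0.mod_add r k q) in E.
  pose proof (Nat.div_mod_eq n q) as D1; pose proof (Nat.div_mod_eq (r + k * q) q) as D2.
  rewrite <- E in D2; set (a := (n / q)%nat) in *; set (b := ((r + k * q) / q)%nat) in *.
  destruct (Nat.le_gt_cases b a); nia.
Qed.

(** The two inequalities say [x_(K-1) <= n < x_K], so the numbers [1, ..., n] meet exactly the first
    [K] members of the progression. *)
Lemma psum_congr {G : AbelianMonoid} (g : nat -> G) (r q : nat) :
  (1 <= r)%nat -> (1 <= q)%nat -> (r <= q)%nat ->
  forall n K, (n < r + K * q)%nat -> (r + K * q <= n + q)%nat ->
  psum (fun k => if congr_mod q (S k) r then g (S k) else zero) n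
  = psum (fun k => g (r + k * q)%nat) K.
Proof.
  intros Hr Hq Hrq n; induction n as [|n IH]; intros K H1 H2.
  - destruct K as [|K]; [reflexivity|]; simpl in H2; lia.
  - destruct (Nat.eq_dec (r + K * q) (S n + q)) as [E|E].
    + destruct K as [|K]; [simpl in E; lia|].
      assert (E' : S n = (r + K * q)%nat) by (simpl in E; lia).
      simpl psum; rewrite (IH K) by lia; rewrite E', congr_mod_prog; reflexivity.
    + simpl psum; rewrite (IH K) by lia.
      rewrite (congr_mod_between r q (S n) K) by lia; apply plus_zero_r.
Qed.

(** To the right of 1 the boundary term has modulus [x_K^(1 - Re s) / q] and vanishes in the limit,
    leaving the series. *)
Lemma zapp_conv_right (r q : nat) (Z : C -> C) :
  (1 <= r)%nat -> (1 <= q)%nat -> (r <= q)%nat -> is_partial_zeta r q Z ->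
  forall s, 1 < fst s -> Ccv (fun K => zapp r q K s) ((s - 1) * Z s)%C.
Proof.
  intros Hr Hq Hrq [HZ _] s Hs eps Heps.
  pose proof (proj1 (is_series_C_eps _ _) (HZ s Hs)) as Hser.
  assert (Hq0 : 0 < INR q) by (apply lt_0_INR; lia).
  assert (Hm : 0 < Cmod (s - 1)).
  { eapply Rlt_le_trans; [|apply fst_le_Cmod]; simpl; apply Rabs_pos_lt; lra. }
  destruct (Hser (eps / 2 / Cmod (s - 1))) as [N1 HN1]; [apply Rdiv_lt_0_compat; lra|].
  destruct (prog_power_lim r q (fst s - 1) Hr Hq ltac:(lra) (eps / 2 * INR q)) as [N2 HN2];
    [apply Rmult_lt_0_compat; lra|].
  exists (N1 + N2 + 2)%nat; intros K HK.
  pose proof (Nat.mul_le_mono_l 1 q K Hq) as HKq.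
  (* The series is indexed by [n - 1] and [sum_n] is inclusive: this index yields exactly the terms
     with [1 <= n < x_K]. As [K >= 2], no subtraction is truncated. *)
  specialize (HN1 (r + K * q - 2)%nat ltac:(lia)); specialize (HN2 K ltac:(lia)).
  rewrite sum_n_psum in HN1.
  replace (S (r + K * q - 2)) with (r + K * q - 1)%nat in HN1 by lia.
  pose proof (psum_congr (G := C_AbelianMonoid) (fun n => nat_cpow_opp n s) r q Hr Hq Hrq
    (r + K * q - 1) K ltac:(lia) ltac:(lia)) as E.
  change (Cmod (psum (G := C_AbelianMonoid) (fun k => if congr_mod q (S k) r
      then nat_cpow_opp (S k) s else @zero C_AbelianMonoid) (r + K * q - 1) - Z s)
    < eps / 2 / Cmod (s - 1)) in HN1.
  rewrite E in HN1; clear E.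
  unfold zapp.
  change (fun k => nat_cpow_opp (r + k * q) s) with (fun k => Cpw (prog r q k) s) in HN1.
  set (P := psum (fun k => Cpw (prog r q k) s) K) in *.
  replace ((s - 1) * P + RtoC (/ INR q) * Cpw (prog r q K) (s - 1) - (s - 1) * Z s)%C
    with ((s - 1) * (P - Z s) + RtoC (/ INR q) * Cpw (prog r q K) (s - 1))%C by ring.
  eapply Rle_lt_trans; [apply Cmod_triangle|].
  rewrite !Cmod_mult, Cmod_R, Cmod_Cpw, Rabs_pos_eq by (apply Rlt_le, Rinv_0_lt_compat; lra).
  replace (- fst (s - 1)%C) with (- (fst s - 1)) by (simpl; ring).
  apply Rlt_div_r in HN1; [|lra].
  apply Rmult_lt_compat_l with (r := / INR q) in HN2; [|apply Rinv_0_lt_compat; lra].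
  replace (/ INR q * (eps / 2 * INR q)) with (eps / 2) in HN2 by (field; lra).
  lra.
Qed.

Lemma zapp_conv (r q : nat) (Z : C -> C) :
  (1 <= r)%nat -> (1 <= q)%nat -> (r <= q)%nat -> is_partial_zeta r q Z ->
  forall s, 0 < fst s -> s <> RtoC 1 -> Ccv (fun K => zapp r q K s) ((s - 1) * Z s)%C.
Proof.
  intros Hr Hq Hrq HZ; pose proof HZ as [_ [Hhol [h [Hh [_ [d Hd]]]]]].
  (* [(s - 1) Z(s)] has a removable singularity at 1. [Z 1] being arbitrary, the value there is
     taken from the numerator [h] of the simple pole. *)
  set (Y := fun s => if Ceq_dec s (RtoC 1) then h (RtoC 1) else ((s - 1) * Z s)%C).
  assert (HY : forall s, s <> RtoC 1 -> Y s = ((s - 1) * Z s)%C)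
    by (intros s Hs; unfold Y; now destruct (Ceq_dec s 1)).
  assert (HYd : forall s, Cdiff Y s).
  { intros s; destruct (Ceq_dec s 1) as [->|Hs].
    - apply (Cdiff_ext_loc h Y (RtoC 1) d (cond_pos d)).
      + intros w Hw; unfold Y; destruct (Ceq_dec w 1) as [->|Hw1]; [reflexivity|].
        rewrite (Hd w).
        * field; intros E; apply Hw1; now apply Ceq_minus.
        (* A disc for [Cmod] lies in the ball of the same radius. *)
        * apply C_NormedModule_mixin_compat1; exact Hw.
        * exact Hw1.
      + now apply holomorphic_at_Cdiff.
    - assert (Hm : 0 < Cmod (s - 1)).
      { apply Cmod_gt_0; intros E; apply Hs; now apply Ceq_minus. }
      apply (Cdiff_ext_loc (fun w => (w - 1) * Z w)%C Y s (Cmod (s - 1)) Hm).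
      + intros w Hw; symmetry; apply HY; intros ->.
        rewrite Cmod_minus_sym in Hw; lra.
      + apply Cdiff_mult; [apply Cdiff_minus; [apply Cdiff_id|apply Cdiff_const]|].
        now apply holomorphic_at_Cdiff, Hhol. }
  intros s Hs Hs1; rewrite <- HY by exact Hs1.
  apply (half_plane_continuation (zapp r q) Y); [|exact HYd| | |exact Hs].
  - intros K z; apply Cdiff_zapp.
  - intros b B Hb; destruct (zapp_cauchy r q b B Hr Hq Hb) as [A [HA HAb]].
    exists (fun K => A * Rpower (prog r q K) (- b)); split; [|exact HAb].
    intros eps Heps.
    destruct (prog_power_lim r q b Hr Hq Hb (eps / (A + 1))) as [N HN];
      [apply Rdiv_lt_0_compat; lra|].
    exists N; intros K HK; specialize (HN K HK).
    assert (0 < Rpower (prog r q K) (- b)) by apply exp_pos.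
    apply Rlt_div_r in HN; [|lra]; nra.
  - intros z Hz; rewrite HY.
    + now apply (zapp_conv_right r q Z).
    + intros ->; simpl in Hz; lra.
Qed.

(** * Taylor expansions at [alpha] in a real increment *)

Lemma is_series_exp (u : R) : is_series (fun m => / INR (fact m) * u ^ m) (exp u).
Proof. apply is_pseries_R, is_exp_Reals. Qed.

Lemma Rpower_taylor (y alpha x : R) :
  is_series (fun m => (-1) ^ m / INR (fact m) * (ln y ^ m / Rpower y alpha) * x ^ m)
    (Rpower y (- (alpha + x))).
Proof.
  replace (Rpower y (- (alpha + x))) with (/ Rpower y alpha * exp (- (ln y * x))).
  - eapply is_series_ext; [|exact (is_series_scal (K := R_AbsRing) (V := R_NormedModule)
      (/ Rpower y alpha) _ _ (is_series_exp (- (ln y * x))))].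
    intros m; unfold scal; simpl; unfold mult; simpl.
    replace (- (ln y * x)) with (-1 * ln y * x) by ring; rewrite !Rpow_mult_distr.
    unfold Rdiv; ring.
  - rewrite <- Rpower_Ropp; unfold Rpower; rewrite <- exp_plus; f_equal; ring.
Qed.

Lemma is_series_geom_abs (u : R) : Rabs u < 1 -> ex_series (fun n => Rabs (u ^ n)).
Proof.
  intros H; exists (/ (1 - Rabs u)).
  eapply is_series_ext; [|apply is_series_geom; now rewrite Rabs_Rabsolu].
  intros n; apply RPow_abs.
Qed.

(** This is where [I_m] comes from. With [b = 1 - alpha], the sum is [y^b / b] times [1 / (1 - x/b)]
    times [e^(-x log y)], and the Cauchy product of the geometric and exponential series has [I_m]
    in its coefficients. The bound on [x] is the radius of the geometric series. *)
Lemma I_fun_taylor (y alpha x : R) : alpha < 1 -> Rabs x < 1 - alpha ->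
  is_series (fun m => (-1) ^ m / INR (fact m) * I_fun m y alpha * x ^ m)
    (Rpower y (1 - alpha - x) / (1 - alpha - x)).
Proof.
  intros Ha Hx; set (b := 1 - alpha) in *; assert (Hb : 0 < b) by (unfold b; lra).
  assert (Hxb : x < b) by (apply Rabs_lt_between in Hx; lra).
  assert (Hu : Rabs (x / b) < 1).
  { unfold Rdiv; rewrite Rabs_mult, (Rabs_pos_eq (/ b)) by (apply Rlt_le, Rinv_0_lt_compat; lra).
    apply Rlt_div_l; lra. }
  pose proof (is_series_mult (fun n => (x / b) ^ n) (fun m => / INR (fact m) * (- (ln y * x)) ^ m)
    _ _ (is_series_geom _ Hu) (is_series_exp _) (is_series_geom_abs _ Hu)) as H.
  assert (Hex : ex_series (fun m => Rabs (/ INR (fact m) * (- (ln y * x)) ^ m))).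
  { exists (exp (Rabs (- (ln y * x)))).
    eapply is_series_ext; [|apply is_series_exp]; intros m; cbv beta.
    rewrite Rabs_mult, <- RPow_abs, Rabs_inv, (Rabs_pos_eq (INR _)) by apply pos_INR.
    reflexivity. }
  specialize (H Hex).
  apply (is_series_scal (K := R_AbsRing) (V := R_NormedModule) (Rpower y b / b)) in H.
  replace (Rpower y (b - x) / (b - x)) with
    (@scal R_AbsRing R_NormedModule (Rpower y b / b) (/ (1 - x / b) * exp (- (ln y * x)))).
  2:{ unfold scal; simpl; unfold mult; simpl; unfold Rpower.
      replace ((b - x) * ln y) with (b * ln y + - (ln y * x)) by ring.
      rewrite exp_plus; field; lra. }
  eapply is_series_ext; [|exact H].
  intros m; unfold scal; simpl; unfold mult; simpl; unfold I_fun; fold b; rewrite sum_n_Reals.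
  set (A := (-1) ^ m / INR (fact m) * x ^ m).
  transitivity (A * Rpower y b * sum_f_R0 (fun i =>
    (-1) ^ i * (INR (fact m) / INR (fact (m - i))) * (ln y ^ (m - i) / b ^ (i + 1))) m);
    [|unfold A; ring].
  rewrite !scal_sum; apply sum_eq; intros i Hi; unfold A.
  replace (- (ln y * x)) with (-1 * ln y * x) by ring.
  unfold Rdiv; rewrite !Rpow_mult_distr, pow_add, pow_1, pow_inv.
  assert (E : x ^ m = x ^ i * x ^ (m - i)) by (rewrite <- pow_add; f_equal; lia).
  assert (E' : (-1) ^ m * (-1) ^ i = (-1) ^ (m - i)).
  { replace m with (i + (m - i))%nat at 1 by lia.
    rewrite pow_add, Rmult_assoc, (Rmult_comm ((-1) ^ (m - i))), <- Rmult_assoc, <- pow_add.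
    replace (i + i)%nat with (2 * i)%nat by lia; rewrite pow_1_even; ring. }
  rewrite E, <- E'.
  assert (INR (fact m) <> 0) by apply INR_fact_neq_0.
  assert (INR (fact (m - i)) <> 0) by apply INR_fact_neq_0.
  assert (b ^ i <> 0) by (apply pow_nonzero; lra).
  field; repeat split; try assumption; lra.
Qed.

(** * The coefficients as limits *)

Ltac req := match goal with |- @eq _ ?a ?b => change (@eq R a b) end.

(** Integration by parts for [log^(m+1) x / x^alpha]: the summand [i = 0] is the boundary term, the
    others are a shifted copy of [I_m]. *)
Lemma I_fun_S (m : nat) (x alpha : R) : alpha < 1 ->
  I_fun (S m) x alpha =
  Rpower x (1 - alpha) * ln x ^ S m / (1 - alpha) - INR (S m) / (1 - alpha) * I_fun m x alpha.
Proof.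
  intros Ha; unfold I_fun; rewrite !sum_n_Reals, decomp_sum by lia.
  set (F := sum_f_R0 _ (pred (S m))).
  assert (E : F = - (INR (S m) / (1 - alpha)) * sum_f_R0 (fun i =>
    (-1) ^ i * (INR (fact m) / INR (fact (m - i))) * (ln x ^ (m - i) / (1 - alpha) ^ (i + 1))) m).
  { unfold F; rewrite scal_sum; simpl pred; apply sum_eq; intros i Hi.
    rewrite fact_simpl, mult_INR; simpl Nat.sub.
    replace (S i + 1)%nat with (S (i + 1)) by lia; simpl pow.
    assert (INR (fact (m - i)) <> 0) by apply INR_fact_neq_0.
    assert ((1 - alpha) ^ (i + 1) <> 0) by (apply pow_nonzero; lra).
    field; repeat split; try assumption; lra. }
  rewrite E; clear E F.
  rewrite Nat.sub_0_r; simpl (0 + 1)%nat; rewrite pow_1, pow_O.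
  assert (INR (fact (S m)) <> 0) by apply INR_fact_neq_0.
  field; split; [lra|assumption].
Qed.

(** The derivative of the boundary term in [I_fun_S] exceeds the target by a multiple of
    [log^m x / x^alpha], which the induction hypothesis removes. *)
Lemma I_fun_derive (m : nat) (x alpha : R) : alpha < 1 -> 0 < x ->
  is_derive (fun x => I_fun m x alpha) x (ln x ^ m / Rpower x alpha).
Proof.
  intros Ha Hx.
  assert (HP : Rpower x (1 - alpha) = x / Rpower x alpha).
  { unfold Rminus; rewrite Rpower_plus, Rpower_1, Rpower_Ropp by exact Hx; reflexivity. }
  assert (Hpos : 0 < Rpower x alpha) by apply exp_pos.
  assert (D : forall n, is_derive (fun x => Rpower x (1 - alpha) * ln x ^ n / (1 - alpha)) x
    (ln x ^ n / Rpower x alpha + INR n / (1 - alpha) * (ln x ^ pred n / Rpower x alpha))).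
  { intros n; unfold Rpower at 1; auto_derive; [tauto|].
    change (exp ((1 - alpha) * ln x)) with (Rpower x (1 - alpha)); rewrite HP.
    field; repeat split; lra. }
  induction m as [|m IH].
  - specialize (D 0%nat).
    apply (is_derive_ext (fun x => Rpower x (1 - alpha) * ln x ^ 0 / (1 - alpha))).
    + intros t; unfold I_fun; rewrite sum_O; simpl; field; lra.
    + replace (ln x ^ 0 / Rpower x alpha) with
        (ln x ^ 0 / Rpower x alpha + INR 0 / (1 - alpha) * (ln x ^ pred 0 / Rpower x alpha));
        [exact D|simpl; field; split; lra].
  - apply (is_derive_ext (fun x => Rpower x (1 - alpha) * ln x ^ S m / (1 - alpha)
      - INR (S m) / (1 - alpha) * I_fun m x alpha)).
    + intros t; symmetry; now apply I_fun_S.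
    + replace (ln x ^ S m / Rpower x alpha) with
        (minus (ln x ^ S m / Rpower x alpha + INR (S m) / (1 - alpha) * (ln x ^ pred (S m) / Rpower x alpha))
           (INR (S m) / (1 - alpha) * (ln x ^ m / Rpower x alpha))).
      * apply (is_derive_minus (V := R_NormedModule)); [apply D|].
        apply (is_derive_scal (fun x => I_fun m x alpha)); exact IH.
      * unfold minus, plus, opp; simpl pred; cbn -[INR pow]; ring.
Qed.

(* From [1 + p ln t <= t^p] with [p = alpha / (m + 1)]. *)
Lemma log_pow_le (m : nat) (alpha t : R) : 0 < alpha -> 1 <= t ->
  Rabs (ln t ^ m / Rpower t alpha) <=
  (INR (S m) / alpha) ^ m * Rpower t (- (alpha / INR (S m))).
Proof.
  intros Ha Ht.
  assert (Hm : 0 < INR (S m)) by (apply lt_0_INR; lia).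
  set (p := alpha / INR (S m)); assert (Hp : 0 < p) by now apply Rdiv_lt_0_compat.
  assert (Hln : 0 <= ln t) by (rewrite <- ln_1; destruct Ht as [Ht| ->]; [apply Rlt_le, ln_increasing; lra|lra]).
  set (u := Rpower t p); assert (Hu : 0 < u) by apply exp_pos.
  assert (Hlu : ln t <= / p * u).
  { assert (1 + p * ln t <= u) by apply exp_ineq1_le.
    apply Rmult_le_reg_l with p; [lra|].
    rewrite <- Rmult_assoc, Rinv_r by lra; lra. }
  assert (Ea : Rpower t alpha = u ^ S m).
  { rewrite <- Rpower_pow by exact Hu; unfold u; rewrite Rpower_mult; f_equal.
    unfold p; field; lra. }
  replace (INR (S m) / alpha) with (/ p) by (unfold p; field; split; lra).
  rewrite Rpower_Ropp; fold u; rewrite Ea.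
  assert (0 < u ^ m) by now apply pow_lt.
  rewrite Rabs_pos_eq.
  - apply Rle_trans with ((/ p * u) ^ m / u ^ S m).
    + apply Rmult_le_compat_r; [apply Rlt_le, Rinv_0_lt_compat; simpl; nra|].
      apply pow_incr; lra.
    + right; rewrite Rpow_mult_distr; simpl; field; lra.
  - apply Rdiv_le_0_compat; [now apply pow_le|simpl; nra].
Qed.

(** Tends to zero for large [x] as long as [y - x] stays bounded, because [alpha > 0]. *)
Lemma I_fun_increment (m : nat) (alpha x y : R) : 0 < alpha < 1 -> 1 <= x -> x <= y ->
  Rabs (I_fun m y alpha - I_fun m x alpha) <=
  (INR (S m) / alpha) ^ m * Rpower x (- (alpha / INR (S m))) * (y - x).
Proof.
  intros Ha Hx Hxy.
  assert (Hm : 0 < INR (S m)) by (apply lt_0_INR; lia).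
  assert (Hp : 0 < alpha / INR (S m)) by (apply Rdiv_lt_0_compat; lra).
  destruct (MVT_gen (fun x => I_fun m x alpha) x y (fun x => ln x ^ m / Rpower x alpha))
    as [c [Hc Ec]].
  - rewrite Rmin_left, Rmax_right by lra; intros t Ht; apply I_fun_derive; lra.
  - rewrite Rmin_left, Rmax_right by lra; intros t Ht.
    apply continuity_pt_filterlim, (ex_derive_continuous (V := R_NormedModule) (fun x => I_fun m x alpha)).
    eexists; apply I_fun_derive; lra.
  - rewrite Rmin_left, Rmax_right in Hc by lra.
    rewrite Ec, Rabs_mult, (Rabs_pos_eq (y - x)) by lra.
    apply Rmult_le_compat_r; [lra|].
    eapply Rle_trans; [apply log_pow_le; lra|].
    apply Rmult_le_compat_l; [apply pow_le, Rdiv_le_0_compat; lra|].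
    apply Rpower_neg_anti; lra.
Qed.

(** The expression under the limit of [zeta_coef], sampled at [x = x_K] but without the term
    [n = x_K], to match [zapp]. *)
Definition zcoef_seq (m : nat) (alpha : R) (r q K : nat) : R :=
  psum (G := R_AbelianMonoid) (fun k => ln (prog r q k) ^ m / Rpower (prog r q k) alpha) K
  - I_fun m (prog r q K) alpha / INR q.

(** [x_K] is the first member of the progression beyond [x]. *)
Lemma log_sum_prog (m : nat) (alpha : R) (r q : nat) (x : R) :
  (1 <= r)%nat -> (1 <= q)%nat -> (r <= q)%nat -> 0 <= x ->
  exists K, x < prog r q K <= x + INR q /\
    log_sum m alpha r q x =
    psum (G := R_AbelianMonoid) (fun k => ln (prog r q k) ^ m / Rpower (prog r q k) alpha) K.
Proof.
  intros Hr Hq Hrq Hx.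
  set (N := Z.to_nat (Int_part x)).
  assert (HN : INR N <= x < INR N + 1).
  { pose proof (base_Int_part x) as [B1 B2].
    assert (0 <= Int_part x)%Z.
    { destruct (Z.le_gt_cases 0 (Int_part x)) as [Hz|Hz]; [exact Hz|].
      assert (IZR (Int_part x) <= -1) by (apply IZR_le; lia); lra. }
    unfold N; rewrite INR_IZR_INZ, Z2Nat.id by assumption; lra. }
  (* The number of members up to [N], that is [(N + 1 - r) / q] rounded up; [r <= q] keeps the
     subtraction exact. *)
  set (K := ((N + q - r) / q)%nat); exists K.
  assert (HK : (N < r + K * q)%nat /\ (r + K * q <= N + q)%nat).
  { pose proof (Nat.div_mod_eq (N + q - r) q) as D; fold K in D.
    pose proof (Nat.mod_upper_bound (N + q - r) q ltac:(lia)).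
    rewrite (Nat.mul_comm K q); lia. }
  split.
  - destruct HK as [H1 H2]; apply le_INR in H1, H2; rewrite S_INR in H1; rewrite (plus_INR N q) in H2.
    unfold prog; lra.
  - unfold log_sum; fold N; rewrite sum_n_m_psum.
    exact (psum_congr (G := R_AbelianMonoid) (fun n => ln (INR n) ^ m / Rpower (INR n) alpha)
      r q Hr Hq Hrq N K (proj1 HK) (proj2 HK)).
Qed.

(** For real [x] the next member satisfies [x < x_K <= x + q] and the sums agree, so the error is
    [(I_m(x_K) - I_m(x)) / q], which tends to zero. This proves that the limit exists, and hence
    that the total [Lim] takes its value. *)
Lemma zeta_coef_lim (m : nat) (alpha : R) (r q : nat) (l : R) : 0 < alpha < 1 ->
  (1 <= r)%nat -> (1 <= q)%nat -> (r <= q)%nat ->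
  is_lim_seq (zcoef_seq m alpha r q) l -> zeta_coef m alpha r q = l.
Proof.
  intros Ha Hr Hq Hrq Hl; unfold zeta_coef.
  rewrite (is_lim_unique _ _ l); [reflexivity|].
  assert (Hq0 : 0 < INR q) by (apply lt_0_INR; lia).
  assert (Hm : 0 < INR (S m)) by (apply lt_0_INR; lia).
  set (p := alpha / INR (S m)); assert (Hp : 0 < p) by (apply Rdiv_lt_0_compat; lra).
  set (C := (INR (S m) / alpha) ^ m).
  assert (HC : 0 <= C) by (apply pow_le, Rdiv_le_0_compat; lra).
  apply is_lim_spec; intros eps; apply is_lim_seq_spec in Hl.
  assert (He : 0 < eps / 2) by (pose proof (cond_pos eps); lra).
  destruct (Hl (mkposreal _ He)) as [N HN]; simpl in HN.
  (* Solves [X^(-p) = eps / 2 / (C + 1)]. *)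
  set (X := Rpower (eps / 2 / (C + 1)) (- / p)).
  exists (Rmax (Rmax 1 X) (prog r q N)); intros x Hx.
  assert (Hx1 : 1 < x /\ X < x /\ prog r q N < x).
  { pose proof (Rmax_l (Rmax 1 X) (prog r q N)); pose proof (Rmax_r (Rmax 1 X) (prog r q N)).
    pose proof (Rmax_l 1 X); pose proof (Rmax_r 1 X); lra. }
  destruct Hx1 as [Hx1 [HxX HxN]].
  destruct (log_sum_prog m alpha r q x Hr Hq Hrq ltac:(lra)) as [K [[HK1 HK2] EK]].
  assert (HNK : (N <= K)%nat).
  { destruct (Nat.le_gt_cases N K) as [H|H]; [exact H|exfalso].
    assert (prog r q K <= prog r q N) by (apply le_INR; nia); lra. }
  specialize (HN K HNK); rewrite EK.
  set (P := psum (G := R_AbelianMonoid) _ K) in *; unfold zcoef_seq in HN; fold P in HN.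
  replace (P - I_fun m x alpha / INR q - l) with
    ((P - I_fun m (prog r q K) alpha / INR q - l)
      + / INR q * (I_fun m (prog r q K) alpha - I_fun m x alpha)) by (field; lra).
  eapply Rle_lt_trans; [apply Rabs_triang|].
  rewrite Rabs_mult, (Rabs_pos_eq (/ INR q)) by (apply Rlt_le, Rinv_0_lt_compat; lra).
  pose proof (I_fun_increment m alpha x (prog r q K) Ha ltac:(lra) ltac:(lra)) as HI.
  fold C in HI; fold p in HI.
  assert (Hxp : Rpower x (- p) < eps / 2 / (C + 1)).
  { assert (Hd : 0 < eps / 2 / (C + 1)) by (apply Rdiv_lt_0_compat; lra).
    replace (eps / 2 / (C + 1)) with (Rpower X (- p)).
    - assert (HX : 0 < X) by apply exp_pos; clearbody X.
      rewrite !Rpower_Ropp; apply Rinv_lt_contravar.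
      + apply Rmult_lt_0_compat; apply exp_pos.
      + apply Rlt_Rpower_l; lra.
    - unfold X; rewrite Rpower_mult; replace (- / p * - p) with 1 by (field; lra).
      now apply Rpower_1. }
  assert (Hxp0 : 0 < Rpower x (- p)) by apply exp_pos.
  apply Rlt_div_r in Hxp; [|lra].
  assert (HI' : Rabs (I_fun m (prog r q K) alpha - I_fun m x alpha) <= C * Rpower x (- p) * INR q).
  { eapply Rle_trans; [exact HI|]; apply Rmult_le_compat_l; [apply Rmult_le_pos; lra|lra]. }
  apply Rmult_le_compat_l with (r := / INR q) in HI'; [|apply Rlt_le, Rinv_0_lt_compat; lra].
  replace (/ INR q * (C * Rpower x (- p) * INR q)) with (C * Rpower x (- p)) in HI' by (field; lra).
  nra.
Qed.

(** * Taylor coefficients of the approximations and their limits *)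

Lemma is_series_RtoC (a : nat -> R) (l : R) : is_series a l ->
  is_series (K := C_AbsRing) (V := C_NormedModule) (fun m => RtoC (a m)) (RtoC l).
Proof.
  intros H; apply is_series_C_eps; intros eps Heps.
  assert (H' : is_lim_seq (sum_n a) l) by exact H.
  apply is_lim_seq_spec in H'; destruct (H' (mkposreal eps Heps)) as [N HN].
  exists N; intros n Hn; specialize (HN n Hn); simpl in HN.
  assert (E : sum_n (G := C_AbelianMonoid) (fun m => RtoC (a m)) n = RtoC (sum_n a n)).
  { clear; induction n as [|n IH]; [now rewrite !sum_O|].
    rewrite !sum_Sn, IH; symmetry; apply RtoC_plus. }
  rewrite E, <- RtoC_minus, Cmod_R; exact HN.
Qed.

Lemma is_series_psum (a : nat -> nat -> R) (l : nat -> R) (K : nat) :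
  (forall k, is_series (a k) (l k)) ->
  is_series (fun m => psum (G := R_AbelianMonoid) (fun k => a k m) K) (psum (G := R_AbelianMonoid) l K).
Proof.
  intros H; induction K as [|K IH]; simpl.
  (* The zero series, obtained as a null multiple of a geometric series. *)
  - assert (E : is_series (fun m => 0 * (0 * 0 ^ m)) (0 * / (1 - 0))).
    { pose proof (is_series_scal (K := R_AbsRing) (V := R_NormedModule) 0 _ _
        (is_series_geom 0 ltac:(rewrite Rabs_R0; lra))) as H1.
      eapply is_series_ext; [|exact H1].
      intros n; unfold scal; simpl; unfold mult; simpl; ring. }
    replace (@zero R_AbelianMonoid) with (0 * / (1 - 0)) by (unfold zero; simpl; req; ring).
    eapply is_series_ext; [|exact E]; intros n; unfold zero; simpl; req; ring.
  - exact (is_series_plus (V := R_NormedModule) _ _ _ _ IH (H K)).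
Qed.

Lemma psum_scal (c : R) (u : nat -> R) (K : nat) :
  psum (G := R_AbelianMonoid) (fun k => c * u k) K = c * psum (G := R_AbelianMonoid) u K.
Proof.
  induction K as [|K IH]; simpl; [unfold zero; simpl; req; ring|].
  rewrite IH; unfold plus; simpl; req; ring.
Qed.

Lemma psum_RtoC (u : nat -> R) (K : nat) :
  psum (G := C_AbelianMonoid) (fun k => RtoC (u k)) K = RtoC (psum (G := R_AbelianMonoid) u K).
Proof.
  induction K as [|K IH]; simpl; [reflexivity|].
  rewrite IH; symmetry; apply RtoC_plus.
Qed.

(** After division by [s - 1] the approximation is the sum of the [x_k^(-s)] minus
    [x_K^(1-s) / (q (1-s))]; [Rpower_taylor] and [I_fun_taylor] expand the two parts. Real
    increments keep every expansion real. *)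
Lemma zapp_real_taylor (alpha : R) (r q K : nat) (x : R) : alpha < 1 -> (1 <= q)%nat ->
  Rabs x < 1 - alpha ->
  is_series (K := C_AbsRing) (V := C_NormedModule)
    (fun m => RtoC ((-1) ^ m / INR (fact m) * zcoef_seq m alpha r q K) * RtoC (x ^ m))%C
    (zapp r q K (RtoC alpha + RtoC x) / (RtoC alpha + RtoC x - 1))%C.
Proof.
  intros Ha Hq Hx.
  assert (Hq0 : 0 < INR q) by (apply lt_0_INR; lia).
  assert (Hx1 : alpha + x - 1 <> 0) by (apply Rabs_lt_between in Hx; lra).
  pose proof (is_series_psum _ _ K (fun k => Rpower_taylor (prog r q k) alpha x)) as H1.
  pose proof (is_series_scal (K := R_AbsRing) (V := R_NormedModule) (/ INR q) _ _
    (I_fun_taylor (prog r q K) alpha x Ha Hx)) as H2.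
  pose proof (is_series_RtoC _ _ (is_series_minus (V := R_NormedModule) _ _ _ _ H1 H2)) as H.
  cbv beta in H.
  match type of H with is_series _ ?l => replace (zapp r q K (RtoC alpha + RtoC x) /
    (RtoC alpha + RtoC x - 1))%C with l end.
  - eapply is_series_C_ext; [|exact H]; intros m; cbv beta.
    rewrite <- RtoC_mult; f_equal; unfold zcoef_seq.
    rewrite (psum_ext _ (fun k => (-1) ^ m / INR (fact m) * x ^ m *
      (ln (prog r q k) ^ m / Rpower (prog r q k) alpha))) by (intros; req; ring).
    rewrite psum_scal; unfold minus, plus, opp, scal; simpl; unfold mult; simpl.
    field; split; (apply INR_fact_neq_0 || lra).
  - unfold zapp.
    rewrite <- RtoC_plus, <- RtoC_minus.
    rewrite (psum_ext _ (fun k => RtoC (Rpower (prog r q k) (- (alpha + x))))) by (intros; apply Cpw_R).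
    rewrite psum_RtoC, Cpw_R, <- !RtoC_mult, <- RtoC_plus, <- RtoC_div by exact Hx1.
    f_equal; unfold minus, plus, opp, scal; simpl; unfold mult; simpl.
    replace (1 - alpha - x) with (- (alpha + x - 1)) by ring.
    field; split; lra.
Qed.

(** Two squares about [alpha] are used: on the one of half-side [rho] only [Z] is expanded, which
    gives the series at [s]; on the smaller one of half-side [rho0] the coefficients are found by
    comparison with the approximations. *)
Theorem theorem2 :
  forall (alpha : R) (r q : nat) (Z : C -> C),
    0 < alpha < 1 ->
    (1 <= r)%nat -> (1 <= q)%nat -> (r <= q)%nat ->
    is_partial_zeta r q Z ->
    forall s : C,
      Cmod (Cminus s (RtoC alpha)) < Rabs (alpha - 1) ->
      is_series (K := C_AbsRing) (V := C_NormedModule)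
        (fun m : nat =>
           Cmult (RtoC ((-1) ^ m / INR (fact m) * zeta_coef m alpha r q))
                 (Cpow (Cminus s (RtoC alpha)) m))
        (Z s).
Proof.
  intros alpha r q Z Ha Hr Hq Hrq HZ s Hs.
  replace (Rabs (alpha - 1)) with (1 - alpha) in Hs
    by (rewrite <- Rabs_Ropp, Rabs_pos_eq; lra).
  pose proof (Cmod_ge_0 (s - RtoC alpha)) as Hs0.
  set (rho := (Cmod (s - RtoC alpha) + (1 - alpha)) / 2).
  assert (Hrho : Cmod (s - RtoC alpha) < rho < 1 - alpha) by (unfold rho; lra).
  (* [rho] may exceed [alpha]; this square stays in [Re w >= alpha / 2], where the approximations
     converge uniformly. *)
  set (rho0 := Rmin rho (alpha / 2)).
  assert (Hrho0 : 0 < rho0 /\ rho0 <= rho /\ rho0 <= alpha / 2).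
  { unfold rho0; repeat split; [apply Rmin_glb_lt; lra|apply Rmin_l|apply Rmin_r]. }
  assert (Hne : forall (z : C) e, 0 < e -> fst z <= 1 - e -> e <= Cmod (z - 1)).
  { intros z e He Hz; eapply Rle_trans; [|apply fst_le_Cmod]; simpl.
    rewrite <- Rabs_Ropp, Rabs_pos_eq; lra. }
  assert (Hhol : forall rho', rho' <= rho -> square (RtoC alpha) rho' (Cdiff Z)).
  { intros rho' Hrho' x y Hx Hy; simpl in Hx, Hy.
    apply holomorphic_at_Cdiff; destruct HZ as [_ [HZ _]]; apply HZ.
    intros E; apply (f_equal fst) in E; simpl in E; lra. }
  destruct (Taylor_square Z (RtoC alpha) rho) as [c [Hc _]]; [lra|apply Hhol; lra|].
  set (e := 1 - alpha - rho); assert (He : 0 < e) by (unfold e; lra).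
  set (f := fun K w => (zapp r q K w / (w - 1))%C).
  assert (Hw1 : forall x y, alpha - rho0 <= x <= alpha + rho0 -> e <= Cmod ((x, y) - 1)).
  { intros x y Hx; apply Hne; [exact He|]; simpl; unfold e; lra. }
  assert (Hf : forall K, square (RtoC alpha) rho0 (Cdiff (f K))).
  { intros K x y Hx Hy; simpl in Hx, Hy; unfold f; apply Cdiff_div; [apply Cdiff_zapp| |].
    - apply Cdiff_minus; [apply Cdiff_id|apply Cdiff_const].
    - apply Cmod_gt_0; specialize (Hw1 x y Hx); lra. }
  destruct (zapp_cauchy r q (alpha / 2) (alpha + rho0 + rho0) Hr Hq ltac:(lra)) as [A [HA HAb]].
  set (T := fun K => A * Rpower (prog r q K) (- (alpha / 2)) / e).
  (* The Cauchy estimate with its upper index sent to infinity, divided by [|w - 1| >= e]. *)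
  assert (HT : forall K, square (RtoC alpha) rho0 (fun w => Cmod (f K w - Z w) <= T K)).
  { intros K x y Hx Hy; simpl in Hx, Hy; specialize (Hw1 x y Hx).
    assert (Hn0 : ((x, y) - 1)%C <> RtoC 0) by (apply Cmod_gt_0; lra).
    unfold f.
    replace (zapp r q K (x, y) / ((x, y) - 1) - Z (x, y))%C with
      ((zapp r q K (x, y) - ((x, y) - 1) * Z (x, y)) / ((x, y) - 1))%C by (field; exact Hn0).
    rewrite Cmod_div by exact Hn0; unfold T.
    apply Rmult_le_compat;
      [apply Cmod_ge_0|apply Rlt_le, Rinv_0_lt_compat; lra| |apply Rinv_le_contravar; lra].
    rewrite Cmod_minus_sym; apply (Ccv_le (fun L => zapp r q L (x, y)) _ _ _ K).
    - apply (zapp_conv r q Z Hr Hq Hrq HZ); [simpl; lra|].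
      intros E; apply Hn0; now apply Ceq_minus in E.
    - intros L HL; apply HAb; [simpl; lra| |exact HL].
      eapply Rle_trans; [apply Cmod_pair_le|].
      assert (Rabs x <= alpha + rho0) by (apply Rabs_le; lra).
      assert (Rabs y <= rho0) by (apply Rabs_le; lra).
      lra. }
  set (d := fun K m => RtoC ((-1) ^ m / INR (fact m) * zcoef_seq m alpha r q K)).
  assert (Hd : forall K m, Cmod (d K m - c m) <= 2 * T K / rho0 ^ m).
  { intros K m.
    destruct (Taylor_square (f K) (RtoC alpha) rho0) as [dK [HdK _]]; [lra|apply Hf|].
    destruct (Taylor_square (fun w => f K w - Z w)%C (RtoC alpha) rho0) as [w [Hw Hwb]]; [lra| |].
    { intros x y Hx Hy; apply Cdiff_minus; [now apply Hf|apply (Hhol rho0); [lra|exact Hx|exact Hy]]. }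
    (* The explicit coefficients are known to represent [f K] on the real axis only, and uniqueness
       there identifies them with the complex ones. *)
    assert (E1 : d K m = dK m).
    { apply (Cseries_coef_unique (d K) dK (fun x => f K (RtoC alpha + RtoC x)%C) rho0); [lra| |].
      - intros x Hx; apply zapp_real_taylor; [lra|exact Hq|lra].
      - exact (has_taylor_real _ _ _ _ HdK). }
    assert (E2 : (dK m - c m)%C = w m).
    { apply (has_taylor_unique (fun w => f K w - Z w)%C (RtoC alpha) rho0 rho0
        (fun m => dK m - c m)%C w); try lra; [|exact Hw].
      apply has_taylor_minus; [exact HdK|].
      intros z Hz; apply Hc; lra. }
    rewrite E1, E2; apply Hwb, HT. }
  assert (Hlim : forall m, Ccv (fun K => d K m) (c m)).
  { intros m; apply (Ccv_squeeze _ _ (fun K => 2 * T K / rho0 ^ m)); [intros K; apply Hd|].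
    intros eps Heps.
    assert (Hp : 0 < rho0 ^ m) by (apply pow_lt; lra).
    set (k := 2 * A / e / rho0 ^ m).
    assert (Hk : 0 <= k) by (unfold k; repeat apply Rdiv_le_0_compat; lra).
    destruct (prog_power_lim r q (alpha / 2) Hr Hq ltac:(lra) (eps / (k + 1))) as [N HN];
      [apply Rdiv_lt_0_compat; lra|].
    exists N; intros K HK; specialize (HN K HK); apply Rlt_div_r in HN; [|lra].
    assert (0 < Rpower (prog r q K) (- (alpha / 2))) by apply exp_pos.
    replace (2 * T K / rho0 ^ m) with (Rpower (prog r q K) (- (alpha / 2)) * k)
      by (unfold T, k; field; lra).
    nra. }
  assert (Hcm : forall m, c m = RtoC ((-1) ^ m / INR (fact m) * zeta_coef m alpha r q)).
  { intros m; specialize (Hlim m).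
    set (g := (-1) ^ m / INR (fact m)).
    pose proof (INR_fact_lt_0 m) as Hfact.
    assert (Hg : g <> 0).
    { unfold g; apply Rmult_integral_contrapositive_currified;
        [apply pow_nonzero; lra|apply Rinv_neq_0_compat; lra]. }
    (* Real parts suffice for the limit, since the approximating coefficients are real. *)
    assert (Hl : is_lim_seq (zcoef_seq m alpha r q) (fst (c m) / g)).
    { apply is_lim_seq_spec; intros eps.
      destruct (Hlim (Rabs g * eps)) as [N HN];
        [apply Rmult_lt_0_compat; [now apply Rabs_pos_lt|apply cond_pos]|].
      exists N; intros K HK; specialize (HN K HK).
      apply Rmult_lt_reg_l with (Rabs g); [now apply Rabs_pos_lt|].
      rewrite <- Rabs_mult; eapply Rle_lt_trans; [|exact HN].
      eapply Rle_trans; [|apply fst_le_Cmod].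
      right; f_equal; unfold d; fold g; simpl; field; exact Hg. }
    rewrite (zeta_coef_lim m alpha r q _ Ha Hr Hq Hrq Hl).
    (* The same real sequence also tends to the real part of [c m], so [c m] is real. *)
    apply (Ccv_unique _ _ _ Hlim); intros eps Heps; destruct (Hlim eps Heps) as [N HN].
    exists N; intros K HK; eapply Rle_lt_trans; [|apply (HN K HK)].
    unfold d; fold g; rewrite <- RtoC_minus, Cmod_R.
    eapply Rle_trans; [|apply fst_le_Cmod].
    right; f_equal; simpl; field; exact Hg. }
  eapply is_series_C_ext; [|apply Hc; lra].
  intros m; cbv beta; now rewrite Hcm.
Qed.
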